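(* Let $\lambda$ be a shifted Young diagram. Then the minimal increasing tableau $M_\lambda$ of type B is a unique rectification target (for $\Delta$). Furthermore, an increasing tableau $T$ of type B rectifies to $M_\lambda$ if and only if $w(T^2)=w(M_\lambda^2)$.
   Context: **Type B.** Let $\Delta=\{[r,c]\in\mathbb{N}^2\mid r\le c\}$ ($\mathbb{N}=\{1,2,3,\dots\}$), with boxes $[r,c]$ in row $r$ (rows numbered top to bottom) and column $c$ (columns numbered left to right), and partial order $[r_1,c_1]\le[r_2,c_2]$ iff $r_1\le r_2$ and $c_1\le c_2$. A straight shape is a finite lower order ideal of $\Delta$, i.e. a shifted Young diagram; a skew shape is $\nu/\lambda:=\nu\setminus\lambda$ with $\lambda\subset\nu$ straight shapes. An increasing tableau of type B is a map $T:\nu/\lambda\to\mathbb{Z}$ on a skew shape in $\Delta$ with $T(\alpha)<T(\beta)$ whenever $\alpha<\beta$. $M_\lambda$ is the increasing tableau of shape $\lambda$ sending $\alpha\in\lambda$ to the maximal cardinality of a totally ordered subset of $\Delta$ with maximal element $\alpha$; thus $M_\lambda([r,c])=r+c-1$. **Slides.** Two boxes of $\Delta$ are neighbors if one covers the other in $\Delta$. For a tableau $Y$ with values in a set $S$ and $s,s'\in S$, $\mathrm{swap}_{s,s'}(Y)$ is the tableau of the same shape sending $\alpha$ to $s'$ if $Y(\alpha)=s$ and $Y(\beta)=s'$ for some neighbor $\beta$ of $\alpha$; to $s$ if $Y(\alpha)=s'$ and $Y(\beta)=s$ for some neighbor $\beta$ of $\alpha$; and to $Y(\alpha)$ otherwise.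 If $T$ is increasing of shape $\nu/\lambda$ with values in $[a,b]$ and $C$ is a set of maximal boxes of $\lambda$, the forward slide $\mathrm{jdt}_C(T)$ is obtained by adding the boxes of $C$ filled with $\bullet$, applying $\mathrm{swap}_{a,\bullet},\mathrm{swap}_{a+1,\bullet},\dots,\mathrm{swap}_{b,\bullet}$ in this order, and deleting all boxes containing $\bullet$. The result is an increasing tableau. A rectification of $T$ is any tableau of straight shape obtained from $T$ by a sequence of forward slides; $T$ rectifies to $U$ if $U$ is a rectification of $T$. An increasing tableau $U$ of straight shape is a unique rectification target if, for every increasing tableau $T$ that has $U$ as a rectification, $U$ is the only rectification of $T$. **Doubling and Hecke permutation.** For an increasing tableau $T$ of type B of shape $\theta$, its doubling $T^2$ is the tableau on $\theta^2=\{[r,c]\in\mathbb{N}^2\mid[r,c]\in\theta\text{ or }[c,r]\in\theta\}$ (a skew shape in $\mathbb{N}^2$) with $T^2([r,c])=T([r,c])$ if $r\le c$ and $T^2([r,c])=T([c,r])$ if $r\ge c$. Let $\Sigma$ be the group of bijections $w:\mathbb{Z}\to\mathbb{Z}$ with $w(x)=x$ for all but finitely many $x$, viewed as a Coxeter group generated by the simple transpositions $s_i=(i,i+1)$, with length function $\ell$. The Hecke product on $\Sigma$ is the associative monoid product determined by $u\cdot s_i=us_i$ if $\ell(us_i)>\ell(u)$ and $u\cdot s_i=u$ otherwise, and $u\cdot v=u\cdot s_{i_1}\cdots s_{i_\ell}$ (multiplied left to right) for any reduced expression $v=s_{i_1}\cdots s_{i_\ell}$. For an increasing tableau $S$ on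 a skew shape in $\mathbb{N}^2$ with row word $(a_1,\dots,a_k)$ (rows read left to right, starting with the bottom row), the Hecke permutation is $w(S)=s_{a_1}\cdot s_{a_2}\cdot\ldots\cdot s_{a_k}$ (Hecke product). $M_\lambda^2$ denotes the doubling of $M_\lambda$. *)

(* Defs.v *)
From HB Require Import structures.
From mathcomp Require Import all_boot all_order all_algebra finmap.
From mathcomp Require Import boolp.
From Stdlib Require Import Relation_Operators.

Set Implicit Arguments.
Unset Strict Implicit.
Unset Printing Implicit Defensive.

Import Order.TTheory GRing.Theory.
Local Open Scope fset_scope.
Local Open Scope fmap_scope.

(* A box (r, c) sits in row r (numbered top to bottom) and column c, both
   numbered from 1.  [<=%O] on [box] is the componentwise order. *)
Notation box := (nat *p nat)%type.

Definition inDelta (x : box) : bool := 0 < x.1 <= x.2.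

(* The principal lower order ideal of Delta generated by x. *)
Definition ideal (x : box) : {fset box} :=
  [fset y : box in [seq ((r, c) : box) | r <- iota 1 x.1, c <- iota 1 x.2]
   | inDelta y].

Lemma in_ideal (x y : box) : (y \in ideal x) = inDelta y && (y <= x)%O.
Proof.
case: x y => [a b] [r c]; rewrite !inE /= andbC [in RHS]leEprod /= !leEnat.
apply/andb_id2l => /andP[/= r0 rc]; apply/allpairsP/andP => /=.
- by move=> [[u v] /=]; rewrite !mem_iota !add1n !ltnS
    => -[/andP[_ ua] /andP[_ vb] [-> ->]].
- move=> [ra cb]; exists (r, c); rewrite !mem_iota !add1n !ltnS.
  by rewrite r0 ra cb (leq_trans r0 rc).
Qed.

Definition covers (x y : box) : bool :=
  [&& inDelta x, inDelta y, (x < y)%O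
    & ~~ has (fun z => (x < z < y)%O) (ideal y)].

Definition neighbor (x y : box) : bool := covers x y || covers y x.

Definition straight (lam : {fset box}) : Prop :=
  (forall x, x \in lam -> inDelta x) /\
  (forall x y, y \in lam -> inDelta x -> (x <= y)%O -> x \in lam).

Notation tableau := {fmap box -> int}.

Definition increasing (T : tableau) : Prop :=
  forall x y : domf T, (val x < val y)%O -> (T x < T y)%R.

Definition skew_shape (theta nu lam : {fset box}) : Prop :=
  [/\ straight nu, straight lam, lam `<=` nu & theta = nu `\` lam].

Definition increasing_tableau (T : tableau) : Prop :=
  (exists nu lam, skew_shape (domf T) nu lam) /\ increasing T.

(* The maximal cardinality of a chain of Delta with maximal element x; any such
   chain is a subset of [ideal x]. *)
Definition height (x : box) : nat :=
  \max_(S <- fpowerset (ideal x)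
        | (x \in S) && all2rel (fun y z => (y >=< z)%O) S) #|` S|.

Definition minimal_tableau (lam : {fset box}) : tableau :=
  [fmap x : lam => Posz (height (val x))].

Definition swap (S : eqType) (s s' : S) (Y : {fmap box -> S}) :
    {fmap box -> S} :=
  [fmap x : domf Y =>
    if (Y x == s) && [exists y : domf Y, neighbor (val x) (val y) && (Y y == s')]
    then s'
    else if (Y x == s') &&
            [exists y : domf Y, neighbor (val x) (val y) && (Y y == s)]
    then s
    else Y x].

(* The entry • is encoded as [None].  For x in C, x is outside the domain of T,
   so that [T.[? x]] is indeed [None]. *)
Definition add_bullets (C : {fset box}) (T : tableau) :
    {fmap box -> option int} :=
  [fmap x : domf T `|` C => T.[? val x]].

(* [:: a; a + 1; ...; b], for a <= b. *)
Definition int_range (a b : int) : seq int :=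
  [seq (a + k%:Z)%R | k <- iota 0 `|b - a|%N.+1].

(* [reducef] deletes the boxes with entry [None]. *)
Definition jdt (a b : int) (C : {fset box}) (T : tableau) : tableau :=
  reducef (foldl (fun Y s => swap (Some s) None Y) (add_bullets C T)
                 (int_range a b)).

Definition maximal_boxes (lam C : {fset box}) : Prop :=
  C `<=` lam /\ forall x y, x \in C -> y \in lam -> ~~ (x < y)%O.

Definition forward_slide (T T' : tableau) : Prop :=
  exists nu lam C : {fset box}, exists a b : int,
    [/\ skew_shape (domf T) nu lam /\ increasing T,
        maximal_boxes lam C,
        (a <= b)%R,
        forall x : domf T, (a <= T x <= b)%R
      & T' = jdt a b C T].

Definition rectifies_to (T U : tableau) : Prop :=
  straight (domf U) /\ clos_refl_trans tableau forward_slide T U.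

Definition unique_rectification_target (U : tableau) : Prop :=
  [/\ increasing_tableau U, straight (domf U)
    & forall T, increasing_tableau T -> rectifies_to T U ->
        forall U', rectifies_to T U' -> U' = U].

Definition transpose (x : box) : box := (x.2, x.1).

Definition doubled_shape (theta : {fset box}) : {fset box} :=
  theta `|` [fset transpose x | x in theta].

Definition doubling (T : tableau) : tableau :=
  [fmap x : doubled_shape (domf T) =>
    (* one of the two boxes is always in the shape: 0 is never used *)
    odflt 0%R T.[? if (val x).1 <= (val x).2 then val x else transpose (val x)]].

(* Rows left to right, starting with the bottom row; [n] bounds all row and
   column numbers occurring in the shape. *)
Definition row_word (S : tableau) : seq int :=
  let n := \max_(x <- domf S) maxn x.1 x.2 in
  flatten [seq pmap (fun c => S.[? ((r, c) : box)]) (iota 1 n)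
          | r <- rev (iota 1 n)].

Record Sigma := MkSigma {
  perm_of :> int -> int;
  perm_of_bij : bijective perm_of;
  perm_of_supp : exists s : seq int, forall x, x \notin s -> perm_of x = x }.

Program Definition Sigma1 : Sigma := @MkSigma id _ _.
Next Obligation. by exists id. Qed.
Next Obligation. by exists [::]. Qed.

(* (u v)(x) = u(v(x)) *)
Program Definition Sigma_mul (u v : Sigma) : Sigma := @MkSigma (u \o v) _ _.
Next Obligation. exact: bij_comp (perm_of_bij u) (perm_of_bij v). Qed.
Next Obligation.
have [[s us] [t vt]] := (perm_of_supp u, perm_of_supp v).
by exists (s ++ t) => x; rewrite mem_cat negb_or => /andP[xs xt]; rewrite vt ?us.
Qed.

Program Definition simple (i : int) : Sigma :=
  @MkSigma
    (fun x => if x == i then i + 1 else if x == i + 1 then i else x)%R _ _.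
Next Obligation.
have iS : (i + 1 == i)%R = false by rewrite -subr_eq0 addrC addKr.
apply: inv_bij => x /=; have [->|/negPf xi] := eqVneq x i; first by rewrite iS eqxx.
by have [->|/negPf xS] := eqVneq x (i + 1)%R; rewrite ?eqxx ?xi ?xS.
Qed.
Next Obligation.
by exists [:: i; (i + 1)%R] => x; rewrite !inE negb_or => /andP[/negPf-> /negPf->].
Qed.

Definition word_prod (a : seq int) : Sigma :=
  foldl (fun u i => Sigma_mul u (simple i)) Sigma1 a.

(* Minimal number of simple transpositions in a product equal to w.  Such a
   product always exists, as the simple transpositions generate Sigma; the
   [else] branch is never taken. *)
Definition coxeter_length (w : Sigma) : nat :=
  if pselect (exists n, `[< exists a, size a = n /\ word_prod a = w >]) is left h
  then ex_minn h else 0.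

Definition hecke_simple (u : Sigma) (i : int) : Sigma :=
  if coxeter_length u < coxeter_length (Sigma_mul u (simple i))
  then Sigma_mul u (simple i) else u.

(* The Hecke product being associative, the Hecke product of the s_(a_i) is
   obtained by successive right multiplications by generators. *)
Definition hecke_perm (S : tableau) : Sigma :=
  foldl hecke_simple Sigma1 (row_word S).

(* Main.v *)
Require Import Defs.
From mathcomp Require Import all_boot all_order all_algebra finmap.
From mathcomp Require Import boolp zify.
From Stdlib Require Import Relation_Operators.

(* The Hecke product acts on arbitrary functions f : int -> int by sorting the
   values at i and i + 1 into decreasing order, so that w(S) is the result of
   sorting the identity along the row word of S.

   Slides commute with doubling, and a slide of the doubled tableau preserves
   the Hecke permutation. To see this, let R_i be the set of entries of row i
   before the slide, K_i the entries of row i that do not move up to row i - 1,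
   and R'_i the entries of row i after the slide. Reading a set as an increasing
   word, R_(i+1) K_i and K_(i+1) R'_i are Hecke equivalent: the entries moving
   between the two rows are exchanged one at a time, largest first, and each
   exchange only uses the equivalences
     [x..z][x..z-1] = [x..z][x..z] = [x+1..z][x..z].
   Applying this from the top row downwards turns R_n ... R_1 into R'_n ... R'_1.

   Every tableau has a rectification, so it remains to see that an increasing
   tableau U of straight shape is determined by w(U^2) when this is w(M^2) for a
   minimal tableau M. Row r of M^2 is [r..r+m_r-1]. Processing this row moves the
   value r to position r + m_r and leaves the function increasing from there on.
   The first fact forces row r of U^2 to start with exactly this run, the second
   one forbids any further entry, and the row can then be cancelled. *)

Set Implicit Arguments.
Unset Strict Implicit.
Unset Printing Implicit Defensive.

Import Order.TTheory GRing.Theory Num.Theory.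

(** * The Hecke product as sorting *)

Ltac int_cases := repeat case: ifP; move=> *; try lia.

Lemma Sigma_ext (u v : Sigma) : perm_of u =1 perm_of v -> u = v.
Proof.
case: u v => [f bf sf] [g bg sg] /= /funext fg; subst g.
by rewrite (Prop_irrelevance bf bg) (Prop_irrelevance sf sg).
Qed.

Lemma word_prod_rcons (a : seq int) (i : int) :
  word_prod (rcons a i) = Sigma_mul (word_prod a) (simple i).
Proof. by rewrite /word_prod -cats1 foldl_cat. Qed.

(** Strong exchange property, by peeling off the last letter [j]. If [p], [q] are [j], [j + 1], this
    letter is deleted; otherwise it keeps the order of [p] and [q], and the induction applies to
    their images. *)
Lemma exchange (a : seq int) (p q : int) :
  (p < q)%R -> (word_prod a q < word_prod a p)%R ->
  exists2 b, size a = (size b).+1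
    & forall x, word_prod b x =
        word_prod a (if x == p then q else if x == q then p else x).
Proof.
elim/last_ind: a p q => [|a j IH] p q pq; first by rewrite /=; lia.
rewrite word_prod_rcons.
have [/andP[/eqP-> /eqP->] _|npq] := boolP ((p == j) && (q == j + 1)%R).
  exists a; rewrite ?size_rcons // => x /=; congr (word_prod a _); int_cases.
move=> /= lt.
have [|b sb hb] := IH _ _ _ lt; first by int_cases.
exists (rcons b j); first by rewrite !size_rcons sb.
by move=> x; rewrite word_prod_rcons /= hb; congr (word_prod a _); int_cases.
Qed.

Lemma coxeter_lengthP (a : seq int) :
  exists2 b, word_prod b = word_prod a
    & size b = coxeter_length (word_prod a).
Proof.
rewrite /coxeter_length; case: pselect => [h|[]]; last first.
  by exists (size a); apply/asboolP; exists a.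
by case: ex_minnP => n /asboolP[b [sb hb]] _; exists b.
Qed.

Lemma coxeter_length_min (a : seq int) :
  coxeter_length (word_prod a) <= size a.
Proof.
rewrite /coxeter_length; case: pselect => [h|//].
by case: ex_minnP => n _; apply; apply/asboolP; exists a.
Qed.

Lemma coxeter_length_descent (a : seq int) (i : int) :
  (word_prod a (i + 1) < word_prod a i)%R ->
  coxeter_length (Sigma_mul (word_prod a) (simple i))
    < coxeter_length (word_prod a).
Proof.
have [b <- <-] := coxeter_lengthP a => lt.
have [|c -> hc] := exchange _ lt; first lia.
suff <- : word_prod c = Sigma_mul (word_prod b) (simple i).
  by rewrite ltnS coxeter_length_min.
by apply: Sigma_ext => x; rewrite hc.
Qed.

Definition sort_at (f : int -> int) (i x : int) : int :=
  if x == i then Num.max (f i) (f (i + 1)%R)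
  else if x == (i + 1)%R then Num.min (f i) (f (i + 1)%R) else f x.

(** The length test in [hecke_simple] amounts to comparing [u i] with [u (i + 1)], by
    [coxeter_length_descent] for [u] or for [u s_i]. The first part allows the next letter to be
    processed in the same way. *)
Lemma hecke_simpleE (a : seq int) (i : int) :
  (exists b, hecke_simple (word_prod a) i = word_prod b) /\
  hecke_simple (word_prod a) i =1 sort_at (word_prod a) i.
Proof.
set u := word_prod a.
have usE : Sigma_mul u (simple i) = word_prod (rcons a i).
  by rewrite word_prod_rcons.
have uinj x y : u x = u y -> x = y by apply: (bij_inj (perm_of_bij u)).
split; first by rewrite /hecke_simple usE; case: ifP => _; eexists.
have [lt|gt|/uinj] := ltgtP (u i) (u (i + 1)%R); last lia.
- have : coxeter_length u < coxeter_length (Sigma_mul u (simple i)).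
    have /= := @coxeter_length_descent (rcons a i) i.
    rewrite word_prod_rcons -/u /=.
    have -> : Sigma_mul (Sigma_mul u (simple i)) (simple i) = u.
      by apply: Sigma_ext => x /=; congr (u _); int_cases.
    apply; move: lt; congr (u _ < u _)%R; int_cases.
  rewrite /hecke_simple /sort_at => -> x /=.
  case: (x =P i) => [_|_]; first lia.
  int_cases.
- rewrite /hecke_simple ltnNge (ltnW (coxeter_length_descent gt)) /= => x.
  rewrite /sort_at; case: (x =P i) => [->|_]; first lia.
  case: (x =P (i + 1)%R) => [->|_]; lia.
Qed.

Definition hecke_word (f : int -> int) (a : seq int) : int -> int :=
  foldl sort_at f a.

Lemma hecke_permE (S : tableau) : hecke_perm S =1 hecke_word id (row_word S).
Proof.
rewrite /hecke_perm.
have -> : @id int = word_prod [::] by [].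
have -> : Sigma1 = word_prod [::] by [].
elim: (row_word S) [::] => [//|i w IH] a x /=.
have [[b hb] hE] := hecke_simpleE a i.
by rewrite hb IH -hb (funext hE).
Qed.

(** All starting functions are allowed, not only permutations, so that common prefixes and suffixes
    can be added without side conditions. *)
Definition hecke_equiv (a b : seq int) : Prop :=
  forall f, hecke_word f a = hecke_word f b.

Lemma hecke_word_cat f a b :
  hecke_word f (a ++ b) = hecke_word (hecke_word f a) b.
Proof. exact: foldl_cat. Qed.

Lemma hecke_equiv_cat a a' b b' :
  hecke_equiv a a' -> hecke_equiv b b' -> hecke_equiv (a ++ b) (a' ++ b').
Proof. by move=> ha hb f; rewrite !hecke_word_cat ha hb. Qed.

Lemma hecke_equiv_trans b a c :
  hecke_equiv a b -> hecke_equiv b c -> hecke_equiv a c.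
Proof. by move=> ab bc f; rewrite ab. Qed.

Lemma hecke_equiv_sym a b : hecke_equiv a b -> hecke_equiv b a.
Proof. by move=> ab f. Qed.

Lemma hecke_idem i : hecke_equiv [:: i; i] [:: i].
Proof. by move=> f; apply: funext => x; rewrite /= /sort_at; int_cases. Qed.

Lemma hecke_comm i j : (i + 1 < j)%R -> hecke_equiv [:: i; j] [:: j; i].
Proof.
move=> ij f; apply: funext => x /=; rewrite /sort_at.
have -> : (j == i) = false by lia.
have -> : (j == i + 1)%R = false by lia.
have -> : (j + 1 == i)%R = false by lia.
have -> : (j + 1 == i + 1)%R = false by lia.
have -> : (i == j) = false by lia.
have -> : (i == j + 1)%R = false by lia.
have -> : (i + 1 == j)%R = false by lia.
have -> : (i + 1 == j + 1)%R = false by lia.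
int_cases.
Qed.

(** Both words sort the values at [i], [i + 1], [i + 2] into decreasing order. *)
Lemma hecke_braid i :
  hecke_equiv [:: i; (i + 1)%R; i] [:: (i + 1)%R; i; (i + 1)%R].
Proof.
move=> f; apply: funext => x /=; rewrite /sort_at.
have -> : (i == i + 1)%R = false by lia.
have -> : (i == i + 1 + 1)%R = false by lia.
have -> : (i + 1 == i)%R = false by lia.
have -> : (i + 1 == i + 1 + 1)%R = false by lia.
have -> : (i + 1 + 1 == i)%R = false by lia.
have -> : (i + 1 + 1 == i + 1)%R = false by lia.
rewrite !eqxx.
rewrite !maxElt !minElt.
move: (f i) (f (i + 1)%R) (f (i + 1 + 1)%R) => u v w.
by case: (x =P i); case: (x =P (i + 1)%R); case: (x =P (i + 1 + 1)%R);
  int_cases.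
Qed.

(** * Moving a letter between two increasing words *)

Section ShiftedWords.
Variable a : int.

(** Letters are counted from [a] by naturals, so that runs of consecutive letters become [iota] and
    increasing words become filtered ranges. *)
Definition letters (s : seq nat) : seq int := [seq (a + k%:Z)%R | k <- s].

Local Notation "u ~~ v" := (hecke_equiv (letters u) (letters v))
  (at level 70).

Lemma nat_equiv_cat u u' v v' : u ~~ u' -> v ~~ v' -> u ++ v ~~ u' ++ v'.
Proof. by rewrite /letters !map_cat; apply: hecke_equiv_cat. Qed.

Lemma nat_equiv_catl u v v' : v ~~ v' -> u ++ v ~~ u ++ v'.
Proof. exact: nat_equiv_cat. Qed.

Lemma nat_equiv_catr u u' v : u ~~ u' -> u ++ v ~~ u' ++ v.
Proof. by move/nat_equiv_cat; apply. Qed.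

Definition far (u v : seq nat) : bool :=
  all (fun x => all (fun y => (x.+1 < y) || (y.+1 < x)) v) u.

Lemma far_comm u v : far u v -> u ++ v ~~ v ++ u.
Proof.
elim: u v => [|x u IH] v /=; first by rewrite cats0.
case/andP => xv uv; apply: (@hecke_equiv_trans (letters (x :: (v ++ u)))).
  by apply: (@nat_equiv_catl [:: x]); apply: IH.
rewrite -cat_cons -[in v ++ _]cat_rcons; apply: nat_equiv_catr.
elim: v xv {uv IH} => [//|y v IHv] /= /andP[xy xv].
apply: (@hecke_equiv_trans (letters ([:: y; x] ++ v))).
  apply: (@nat_equiv_catr [:: x; y]).
  case/orP: xy => xy; last apply: hecke_equiv_sym; apply: hecke_comm; lia.
by apply: (@nat_equiv_catl [:: y]); apply: IHv.
Qed.

(** Induction on [n]: the letter [x + n.+1] moves right past [iota x n], the induction hypothesis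
    applies to what now precedes it, a braid relation produces a new [x + n.+1] further left, and
    this one moves back past [iota x n]. *)
Lemma run_shift x n : iota x n.+1 ++ iota x n ~~ iota x.+1 n ++ iota x n.+1.
Proof.
elim: n => [//|n IH].
have E k : iota x k.+1 = iota x k ++ [:: x + k] by rewrite -[k.+1]addn1 iotaD.
have comm_top : [:: x + n.+1] ++ iota x n ~~ iota x n ++ [:: x + n.+1].
  apply: far_comm; rewrite /far /= andbT; apply/allP => k.
  rewrite mem_iota; lia.
apply: (@hecke_equiv_trans
  (letters ((iota x n.+1 ++ iota x n) ++ [:: x + n.+1; x + n]))).
  rewrite (E n.+1) {2}(E n) -!catA; apply: nat_equiv_catl.
  by rewrite !catA -[[:: _; _]]/([:: x + n.+1] ++ _) catA; apply: nat_equiv_catr.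
apply: (@hecke_equiv_trans
  (letters ((iota x.+1 n ++ iota x n.+1) ++ [:: x + n.+1; x + n]))).
  exact: nat_equiv_catr.
rewrite (E n.+1) {1}(E n).
have -> : iota x.+1 n.+1 = iota x.+1 n ++ [:: x + n.+1].
  by rewrite -[in LHS](addn1 n) iotaD /= addSnnS.
rewrite -!catA; apply: nat_equiv_catl.
apply: (@hecke_equiv_trans
  (letters (iota x n ++ [:: x + n.+1; x + n; x + n.+1]))).
  apply: nat_equiv_catl; have /= := hecke_braid (a + (x + n)%:Z).
  have -> : (a + (x + n)%:Z + 1)%R = (a + (x + n.+1)%:Z)%R by lia.
  by [].
rewrite E -catA -[[:: _; _; _]]/([:: x + n.+1] ++ [:: x + n; x + n.+1]).
rewrite [X in X ~~ _]catA [X in _ ~~ X]catA; apply: nat_equiv_catr.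
exact: hecke_equiv_sym.
Qed.

(** After [run_shift], the extra final letter [x + n] meets the last letter of [iota x n.+1], which
    is the same, and the two merge. *)
Lemma run_absorb x n : iota x n.+1 ++ iota x n ~~ iota x n.+1 ++ iota x n.+1.
Proof.
apply: (hecke_equiv_trans (run_shift x n)).
have E k : iota x k.+1 = iota x k ++ [:: x + k] by rewrite -[k.+1]addn1 iotaD.
apply: hecke_equiv_sym.
rewrite {2}E catA.
apply: hecke_equiv_trans (nat_equiv_catr _ (run_shift x n)) _.
rewrite -catA; apply: nat_equiv_catl.
by rewrite E -catA; apply: nat_equiv_catl; apply: hecke_idem.
Qed.

Definition word_of (m : nat) (P : nat -> bool) : seq nat :=
  [seq k <- iota 0 m | P k].

Lemma word_of_split m (P : nat -> bool) x n :
  x + n <= m -> (forall v, x <= v < x + n -> P v) ->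
  word_of m P = [seq k <- iota 0 x | P k] ++ iota x n
                ++ [seq k <- iota (x + n) (m - (x + n)) | P k].
Proof.
move=> xnm Pxn; rewrite /word_of -[in LHS](subnKC xnm) iotaD filter_cat.
rewrite iotaD filter_cat -catA; congr (_ ++ (_ ++ _)).
by apply/all_filterP/allP => k; rewrite mem_iota => /Pxn.
Qed.

Variables (m : nat) (L U : nat -> bool) (x z : nat).
Hypotheses (xz : x <= z) (zm : z < m).
Hypothesis Lrun : forall v, x <= v <= z -> L v.
Hypothesis Urun : forall v, x <= v < z -> U v.
Hypothesis Lz : ~~ L z.+1.
Hypothesis Ux : forall v, v.+1 = x -> ~~ U v.

Let lowU := [seq k <- iota 0 x | U k].
Let highL := [seq k <- iota z.+1 (m - z.+1) | L k].

(** By [Lz] and [Ux], the letters of [highL] are at least [z + 2] and those of [lowU] at most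
    [x - 2], hence far from the run [[x..z]]. *)
Let mid_comm y n : x <= y -> y + n <= z.+1 ->
  iota y n ++ (highL ++ lowU) ~~ (highL ++ lowU) ++ iota y n.
Proof.
move=> xy yn; apply: far_comm; apply/allP => k; rewrite mem_iota => kP.
apply/allP => l; rewrite mem_cat !mem_filter !mem_iota => /orP[]/andP[hl lP].
- have : l != z.+1 by apply: contraNneq Lz => <-.
  lia.
- have : l.+1 != x by apply/eqP => /Ux; rewrite hl.
  lia.
Qed.

Let splitL : word_of m L =
  [seq k <- iota 0 x | L k] ++ iota x (z - x).+1 ++ highL.
Proof.
have e : x + (z - x).+1 = z.+1 by lia.
by rewrite (@word_of_split m L x (z - x).+1) e // => v hv; apply: Lrun.
Qed.

(** Only [highL] and [lowU] separate the two runs. Commuting them away reduces the claim to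
    [run_absorb] for [[x..z][x..z-1]]. *)
Lemma word_gain : word_of m L ++ word_of m U ~~
  word_of m L ++ word_of m (fun v => U v || (v == z)).
Proof.
have [Uz|nUz] := boolP (U z).
  suff -> : word_of m (fun v => U v || (v == z)) = word_of m U by [].
  by apply: eq_filter => v; case: eqP => [->|_]; rewrite ?Uz ?orbF.
have -> : word_of m U = lowU ++ iota x (z - x)
    ++ [seq k <- iota z.+1 (m - z.+1) | U k].
  rewrite (@word_of_split m U x (z - x)); try lia; last first.
    by move=> v hv; apply: Urun; lia.
  have -> : m - (x + (z - x)) = (m - z.+1).+1 by lia.
  by rewrite subnKC //= (negPf nUz).
have -> : word_of m (fun v => U v || (v == z)) = lowU ++ iota x (z - x).+1
    ++ [seq k <- iota z.+1 (m - z.+1) | U k].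
  rewrite (@word_of_split m _ x (z - x).+1); try lia; last first.
    by move=> v hv; case: eqP => [|/eqP vz]; rewrite ?orbT // Urun //; lia.
  have -> : x + (z - x).+1 = z.+1 by lia.
  by congr (_ ++ (_ ++ _)); apply: eq_in_filter => k;
    rewrite mem_iota; case: (k =P z) => [->|]; rewrite ?orbF //; lia.
rewrite splitL -!catA; apply: nat_equiv_catl.
(* Brings the run of [L] next to the run of [U]. *)
have push (n : nat) : iota x (z - x).+1 ++ highL ++ lowU ++ iota x n ~~
    (highL ++ lowU) ++ iota x (z - x).+1 ++ iota x n.
  rewrite [highL ++ _]catA [X in X ~~ _]catA [X in _ ~~ X]catA.
  by apply: nat_equiv_catr; apply: mid_comm; lia.
rewrite [lowU ++ iota x (z - x) ++ _]catA [lowU ++ iota x _.+1 ++ _]catA.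
rewrite ![highL ++ (_ ++ _) ++ _]catA ![iota x _.+1 ++ _ ++ [seq _ <- _ | U _]]catA.
apply: nat_equiv_catr; apply: hecke_equiv_trans (push _) _.
apply: hecke_equiv_trans (hecke_equiv_sym (push _)).
by apply: nat_equiv_catl; apply: run_absorb.
Qed.

(** After the same commutations, [[x..z][x..z]] becomes [[x+1..z][x..z]] by [run_absorb] and
    [run_shift]. *)
Lemma word_loss : U z ->
  word_of m L ++ word_of m U ~~
  word_of m (fun v => L v && (v != x)) ++ word_of m U.
Proof.
move=> Uz.
have -> : word_of m U = lowU ++ iota x (z - x).+1
    ++ [seq k <- iota z.+1 (m - z.+1) | U k].
  have e : x + (z - x).+1 = z.+1 by lia.
  rewrite (@word_of_split m U x (z - x).+1) e // => v hv.
  by case: (v =P z) => [->//|vz]; apply: Urun; lia.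
have -> : word_of m (fun v => L v && (v != x)) =
    [seq k <- iota 0 x | L k] ++ iota x.+1 (z - x) ++ highL.
  rewrite (@word_of_split m _ x.+1 (z - x)); try lia; last first.
    by move=> v hv; rewrite Lrun; lia.
  have -> : x.+1 + (z - x) = z.+1 by lia.
  rewrite -[in iota 0 x.+1](addn1 x) iotaD filter_cat /= eqxx andbF cats0.
  by congr (_ ++ (_ ++ _)); apply: eq_in_filter => k;
    rewrite mem_iota; case: (k =P x) => [->|]; rewrite ?andbT //; lia.
rewrite splitL -!catA; apply: nat_equiv_catl.
have push (y n k : nat) : x <= y -> y + n <= z.+1 ->
    iota y n ++ highL ++ lowU ++ iota x k ~~
    (highL ++ lowU) ++ iota y n ++ iota x k.
  move=> xy yn; rewrite [highL ++ _]catA [X in X ~~ _]catA [X in _ ~~ X]catA.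
  by apply: nat_equiv_catr; apply: mid_comm.
rewrite ![lowU ++ iota x _ ++ _]catA.
rewrite ![highL ++ (_ ++ _) ++ _]catA ![iota _ _ ++ _ ++ [seq _ <- _ | U _]]catA.
apply: nat_equiv_catr; apply: hecke_equiv_trans (push _ _ _ _ _) _; try lia.
apply: hecke_equiv_trans (hecke_equiv_sym (push _ _ _ _ _)); try lia.
apply: nat_equiv_catl; apply: hecke_equiv_trans (run_shift _ _).
exact: hecke_equiv_sym (run_absorb _ _).
Qed.

End ShiftedWords.

(** * Slides on a grid *)

Lemma some_eqE (T : eqType) (x y : T) : (Some x == Some y) = (x == y).
Proof. by []. Qed.

(* At index 0 the truncated predecessor gives the box itself; this is harmless,
   as row 0 and column 0 will be empty. *)
Definition some_nbr (P : nat -> nat -> bool) (i j : nat) : bool :=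
  [|| P i.+1 j, P i j.+1, P i.-1 j | P i j.-1].

(** [None] stands for a box outside the shape, [Some None] for a bullet and [Some (Some v)] for an
    entry. *)
Definition swap_grid (k : nat) (y : nat -> nat -> option (option nat))
    (i j : nat) : option (option nat) :=
  if (y i j == Some (Some k)) && some_nbr (fun i j => y i j == Some None) i j
  then Some None
  else if (y i j == Some None) &&
          some_nbr (fun i j => y i j == Some (Some k)) i j
  then Some (Some k)
  else y i j.

Section GridSlide.
Variables (t : nat -> nat -> option nat) (C : nat -> nat -> bool).

Definition in_grid i j := C i j || (t i j : bool).

Hypothesis t_incr : forall i j u i' j' v,
  t i j = Some u -> t i' j' = Some v -> i <= i' -> j <= j' ->
  i + j < i' + j' -> u < v.
Hypothesis grid_convex : forall i j i' j' x y,
  in_grid i j -> in_grid i' j' -> i <= x <= i' -> j <= y <= j' -> in_grid x y.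
Hypothesis C_below : forall i j u i' j',
  t i j = Some u -> C i' j' -> i <= i' -> j <= j' -> False.
Hypothesis C_antichain : forall i j i' j',
  C i j -> C i' j' -> i <= i' -> j <= j' -> i = i' /\ j = j'.
Hypothesis grid_row0 : forall j, in_grid 0 j = false.
Hypothesis grid_col0 : forall i, in_grid i 0 = false.

(* The tableau just before [k] is swapped with the bullets, which are the boxes
   in state [Some None]. *)
Fixpoint grid_state (k : nat) : nat -> nat -> option (option nat) :=
  if k is k'.+1 then swap_grid k' (grid_state k')
  else fun i j => if t i j is Some v then Some (Some v)
                  else if C i j then Some None else None.

Definition bullet k i j := grid_state k i j == Some None.
(** Later swaps involve only larger values and bullets, so these are the final positions of [k]; see
    [grid_state_final]. *)
Definition settled k i j := grid_state k.+1 i j == Some (Some k).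

Lemma grid_state_dom k i j : (grid_state k i j : bool) = in_grid i j.
Proof.
elim: k i j => [|k IH] i j /=.
  by rewrite /in_grid; case: (t i j) => [v|]; case: (C i j).
rewrite -IH /swap_grid; case: ifP => [/andP[/eqP-> _]//|_].
by case: ifP => [/andP[/eqP-> _]//|_].
Qed.

Lemma grid_state_initial k v i j :
  k <= v -> (grid_state k i j == Some (Some v)) = (t i j == Some v).
Proof.
elim: k v i j => [|k IH] v i j kv /=.
  by case: (t i j) => [w|] //; case: (C i j).
have IHv := IH v i j (ltnW kv).
rewrite /swap_grid; case: ifP => [/andP[/eqP e _]|_].
  by rewrite -IHv e !some_eqE ltn_eqF.
case: ifP => [/andP[/eqP e _]|_] //.
by rewrite -IHv e !some_eqE ltn_eqF.
Qed.

Lemma bullet_initial k i j :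
  bullet k i j -> C i j \/ exists2 v, v < k & t i j = Some v.
Proof.
move=> /eqP e; have := grid_state_dom k i j; rewrite e /in_grid.
case: (C i j); first by left.
case tE: (t i j) => [v|//] _; right; exists v => //.
rewrite ltnNge; apply/negP => kv.
by have := grid_state_initial i j kv; rewrite e tE eqxx.
Qed.

Lemma bullet_in_grid k i j : bullet k i j -> in_grid i j.
Proof. by move=> /eqP e; rewrite -(grid_state_dom k) e. Qed.

Lemma in_grid_t i j v : t i j = Some v -> in_grid i j.
Proof. by rewrite /in_grid => ->; rewrite orbT. Qed.

(** A bullet sits either on a box of [C], excluded by [C_below], or on a box whose original entry is
    less than [k], excluded by monotonicity. *)
Lemma no_bullet_above k v i j i' j' :
  t i j = Some v -> k <= v -> i <= i' -> j <= j' -> bullet k i' j' = false.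
Proof.
move=> tv kv ii jj; apply/negP => /bullet_initial[Cij|[w wk tw]].
  exact: C_below tv Cij ii jj.
have [lt|] := ltnP (i + j) (i' + j').
  have := t_incr tv tw ii jj lt; lia.
move=> le; have [ei ej] : i = i' /\ j = j' by lia.
by move: tw; rewrite -ei -ej tv => -[]; lia.
Qed.

Lemma nbr_bulletE k i j : t i j = Some k ->
  some_nbr (bullet k) i j = bullet k i j.-1 || bullet k i.-1 j.
Proof.
move=> tk; rewrite /some_nbr.
have nb := no_bullet_above tk (leqnn k).
by rewrite (nb _ _ (leqnSn i) (leqnn j)) (nb _ _ (leqnn i) (leqnSn j)) /= orbC.
Qed.

Lemma nbr_valueE k i j : bullet k i j ->
  some_nbr (fun i j => grid_state k i j == Some (Some k)) i j
  = (t i j.+1 == Some k) || (t i.+1 j == Some k).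
Proof.
move=> b; rewrite /some_nbr !grid_state_initial //.
have -> : t i.-1 j == Some k = false.
  apply/negP => /eqP tk; have := no_bullet_above tk (leqnn k) (leq_pred i) (leqnn j).
  by rewrite b.
have -> : t i j.-1 == Some k = false.
  apply/negP => /eqP tk; have := no_bullet_above tk (leqnn k) (leqnn i) (leq_pred j).
  by rewrite b.
by rewrite !orbF orbC.
Qed.

(** By [no_bullet_above], an entry [k] can only meet bullets on its left and above it, and a bullet
    can only meet [k] on its right and below it. *)
Lemma bulletS k i j : bullet k.+1 i j =
  (bullet k i j && ~~ ((t i j.+1 == Some k) || (t i.+1 j == Some k)))
  || ((t i j == Some k) && (bullet k i j.-1 || bullet k i.-1 j)).
Proof.
rewrite {1}/bullet /= /swap_grid grid_state_initial // -/(bullet k i j).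
have [/eqP tk|tk] /= := boolP (t i j == Some k).
  rewrite -[some_nbr _ i j]/(some_nbr (bullet k) i j) nbr_bulletE //.
  have -> : bullet k i j = false by exact: (no_bullet_above tk).
  by case: ifP => //= _; have := no_bullet_above tk (leqnn k) (leqnn i) (leqnn j).
rewrite orbF; have [b|b] := boolP (bullet k i j) => /=; last exact/negbTE.
by rewrite nbr_valueE //; case: ifP => _.
Qed.

Lemma settledE k i j : settled k i j =
  ((t i j == Some k) && ~~ (bullet k i j.-1 || bullet k i.-1 j))
  || (bullet k i j && ((t i j.+1 == Some k) || (t i.+1 j == Some k))).
Proof.
rewrite /settled /= /swap_grid grid_state_initial // -/(bullet k i j).
have [/eqP tk|tk] /= := boolP (t i j == Some k).
  rewrite -[some_nbr _ i j]/(some_nbr (bullet k) i j) nbr_bulletE //.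
  have -> : bullet k i j = false by exact: (no_bullet_above tk).
  by case: ifP => //= _; rewrite grid_state_initial // tk eqxx.
have [b|b] := boolP (bullet k i j) => /=; last first.
  by rewrite grid_state_initial //; apply/negbTE.
by rewrite nbr_valueE //; case: ifP => _; rewrite ?eqxx // grid_state_initial //;
  apply/negbTE.
Qed.

Lemma grid_state_final v k i j :
  v < k -> (grid_state k i j == Some (Some v)) = settled v i j.
Proof.
elim: k => [//|k IH]; rewrite ltnS leq_eqVlt => /orP[/eqP->//|vk].
rewrite -(IH vk) /= /swap_grid; case: ifP => [/andP[/eqP-> _]|_].
  by rewrite !some_eqE gtn_eqF.
by case: ifP => [/andP[/eqP-> _]|_] //; rewrite !some_eqE gtn_eqF.
Qed.

(** Initially this is the antichain property of [C]. A bullet that stays at step [k] has no [k] on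
    its right or below, and a bullet that enters a box of entry [k] has larger entries there. *)
Lemma bullet_adjacent k i j i' j' :
  bullet k i j -> in_grid i' j' ->
  (i' = i.+1 /\ j' = j) \/ (i' = i /\ j' = j.+1) ->
  exists2 v, k <= v & t i' j' = Some v.
Proof.
move=> b g adj.
have [ii jj lt] : [/\ i <= i', j <= j' & i + j < i' + j'] by split; lia.
elim: k b => [|k IH] b.
  have Cij : C i j by case/bullet_initial: b => // -[].
  have : ~~ C i' j'.
    by apply/negP => C'; have := C_antichain Cij C' ii jj; lia.
  by case/orP: g => [->//|]; case: (t i' j') => // v _ _; exists v.
move: b; rewrite bulletS => /orP[/andP[/IH[v kv tv]]|/andP[/eqP tk _]].
  rewrite negb_or => /andP[h1 h2]; exists v => //.
  rewrite ltn_neqAle kv andbT; apply/eqP => e; subst v.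
  by case: adj => -[e1 e2]; subst i' j'; rewrite tv eqxx in h1 h2.
case/orP: g => [C'|]; first by case: (C_below tk C' ii jj).
case tE: (t i' j') => [v|//] _; exists v => //.
exact: t_incr tk tE ii jj lt.
Qed.

(** Convexity provides a box of the grid next to the bullet on the way to [(i', j')]; its entry is
    at least [k], and entries increase from there. *)
Lemma bullet_above k i j i' j' :
  bullet k i j -> in_grid i' j' -> i <= i' -> j <= j' -> i + j < i' + j' ->
  exists2 v, k <= v & t i' j' = Some v.
Proof.
move=> b g ii jj lt.
have aux x y : i <= x -> j <= y -> x <= i' -> y <= j' ->
    (x = i.+1 /\ y = j) \/ (x = i /\ y = j.+1) ->
    exists2 v, k <= v & t i' j' = Some v.
  move=> ix jy xi yj adj.
  have gxy : in_grid x y.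
    by apply: grid_convex (bullet_in_grid b) g _ _; rewrite ?ix ?jy.
  have [v kv tv] := bullet_adjacent b gxy adj.
  case/orP: g => [C'|]; first by case: (C_below tv C' xi yj).
  case tE: (t i' j') => [w|//] _; exists w => //.
  have [lt'|ge] := ltnP (x + y) (i' + j').
    by have := t_incr tv tE xi yj lt'; lia.
  have [ei ej] : x = i' /\ y = j' by lia.
  by subst x y; move: tE; rewrite tv => -[<-].
have [ji|ji] := ltnP j j'; first by apply: (aux i j.+1); lia.
by apply: (aux i.+1 j); lia.
Qed.

(** This makes the slid tableau increasing. The critical case is that [v'] settles at the current
    step. *)
Lemma settled_incr k i j i' j' v' :
  grid_state k i' j' = Some (Some v') -> v' < k ->
  in_grid i j -> i <= i' -> j <= j' -> i + j < i' + j' ->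
  exists2 v, v < v' & grid_state k i j = Some (Some v).
Proof.
move=> sv' v'k g ii jj lt; elim: k v'k sv' => [//|k IH].
have keep v : v < k -> grid_state k i j = Some (Some v) ->
    grid_state k.+1 i j = Some (Some v).
  by move=> vk /eqP; rewrite (grid_state_final _ _ vk)
    -(grid_state_final _ _ (leqW vk)) => /eqP.
rewrite ltnS leq_eqVlt => /orP[/eqP e|v'k]; last first.
  move=> /eqP; rewrite (grid_state_final _ _ (leqW v'k)).
  rewrite -(grid_state_final _ _ v'k) => /eqP /(IH v'k)[v vv' sv].
  by exists v => //; apply: keep => //; lia.
subst v' => /eqP; rewrite grid_state_final // settledE => F.
suff [v vk sv] : exists2 v, v < k & grid_state k i j = Some (Some v).
  by exists v => //; apply: keep.
case sE: (grid_state k i j) => [[v|]|]; last 1 first.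
- by have := grid_state_dom k i j; rewrite sE g.
- exists v => //; rewrite ltnNge; apply/negP => kv.
  have /eqP tv : t i j == Some v by rewrite -(grid_state_initial _ _ kv) sE.
  case/orP: F => [/andP[/eqP tk _]|/andP[b _]].
    by have := t_incr tv tk ii jj lt; lia.
  by rewrite (no_bullet_above tv kv ii jj) in b.
(* A bullet at [(i, j)] is impossible. Two comparable bullets contradict [bullet_above]. If instead
   [k] stays in place, a box strictly between would have an entry at least [k] and less than [k];
   the bullet is therefore adjacent to [k], which would have to move. *)
have b : bullet k i j by apply/eqP.
case/orP: F => [/andP[/eqP tk]|/andP[b' _]]; last first.
  have [w kw tw] := bullet_above b (bullet_in_grid b') ii jj lt.
  by rewrite (no_bullet_above tw kw (leqnn _) (leqnn _)) in b'.
case/norP => nl nu.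
have aux x y : i <= x -> j <= y -> x <= i' -> y <= j' -> i + j < x + y ->
    x = i' /\ y = j'.
  move=> ix jy xi yj lt'.
  have gxy : in_grid x y.
    by apply: grid_convex g (in_grid_t tk) _ _; rewrite ?ix ?jy.
  have [w kw tw] := bullet_above b gxy ix jy lt'.
  have [lt2|ge] := ltnP (x + y) (i' + j'); last by lia.
  by have := t_incr tw tk xi yj lt2; lia.
have [ji|ji] := ltnP j j'.
  have [ei ej] : i = i' /\ j.+1 = j' by apply: aux; lia.
  by subst i' j'; rewrite b in nl.
have [ei ej] : i.+1 = i' /\ j = j' by apply: aux; lia.
by subst i' j'; rewrite b in nu.
Qed.

(* [gained i v] and [lost i v] compare row [i] before and after the slide: [v]
   enters row [i] from row [i.+1], respectively leaves it to row [i.-1]. *)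
Definition row_has i v : bool := `[< exists j, t i j = Some v >].
Definition lost i v : bool :=
  `[< exists j, [/\ t i j = Some v, bullet v i.-1 j & ~~ bullet v i j.-1] >].
Definition kept i v : bool := row_has i v && ~~ lost i v.
Definition gained i v : bool :=
  ~~ row_has i v && `[< exists j, bullet v i j && (t i.+1 j == Some v) >].
Definition final_row_has i v : bool := kept i v || gained i v.

Lemma row_inj i j j' v : t i j = Some v -> t i j' = Some v -> j = j'.
Proof.
move=> tj tj'; have [lt|lt|//] := ltngtP j j'.
  by have := t_incr tj tj' (leqnn i) (ltnW lt); lia.
by have := t_incr tj' tj (leqnn i) (ltnW lt); lia.
Qed.

(** The entry right of the bullet is at least [v] by [bullet_adjacent], and at most [v] as [v]
    occurs there or further right. With a bullet on its left, [v] moves left and remains in its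
    row. *)
Lemma bullet_row_has v i j :
  bullet v i j -> row_has i v -> t i j.+1 = Some v /\ kept i v.
Proof.
move=> b rv; have /asboolP[j' tj'] := rv.
have jj' : j < j'.
  rewrite ltnNge; apply/negP => le.
  by rewrite (no_bullet_above tj' (leqnn v) (leqnn i) le) in b.
have g : in_grid i j.+1.
  by apply: grid_convex (bullet_in_grid b) (in_grid_t tj') _ _; lia.
have [w vw tw] : exists2 w, v <= w & t i j.+1 = Some w.
  by apply: bullet_adjacent b g _; right.
have ej : j' = j.+1.
  have [lt|] := ltnP j.+1 j'; last by lia.
  by have := t_incr tw tj' (leqnn i) (ltnW lt); lia.
subst j'; split=> //; rewrite /kept rv /=; apply/asboolPn => -[j2 [t2 _]].
by rewrite (row_inj t2 tj') b.
Qed.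

(** An entry with bullets both on its left and above it is copied into both boxes. This is why
    [lost] excludes a bullet on the left, and [gained] a value already present in the row. *)
Lemma final_rowP i v :
  reflect (exists j, settled v i j) (final_row_has i v).
Proof.
apply: (iffP idP) => [|[j]].
  case/orP => [/andP[/asboolP[j tj] nl]|/andP[_ /asboolP[j /andP[b tj]]]]; last first.
    by exists j; rewrite settledE b tj !orbT.
  have [bl|nbl] := boolP (bullet v i j.-1).
    exists j.-1; rewrite settledE bl.
    case: j tj {nl bl} => [/in_grid_t|j ->]; first by rewrite grid_col0.
    by rewrite eqxx orbT.
  have [bu|nbu] := boolP (bullet v i.-1 j).
    by case/asboolP: nl; exists j.
  by exists j; rewrite settledE tj eqxx (negPf nbl) (negPf nbu).
rewrite settledE => /orP[/andP[/eqP tj /norP[nl nu]]|/andP[b]].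
  apply/orP; left; apply/andP; split; first by apply/asboolP; exists j.
  apply/asboolPn => -[j' [tj' bu _]].
  by rewrite (row_inj tj' tj) (negPf nu) in bu.
case/orP => /eqP tv.
  have rv : row_has i v by apply/asboolP; exists j.+1.
  by have [_ kv] := bullet_row_has b rv; rewrite /final_row_has kv.
have [rv|nrv] := boolP (row_has i v).
  by have [_ kv] := bullet_row_has b rv; rewrite /final_row_has kv.
apply/orP; right; rewrite /gained nrv; apply/asboolP; exists j.
by rewrite b tv eqxx.
Qed.

(** * Two adjacent rows before and after a slide *)

Section TwoRows.
Variable i : nat.

(** The entry [v] of row [i] must have been in column [j], where its departure created the bullet;
    being kept, it went left. The entry below its new box is at least [v] and less than [v.+1]. *)
Lemma bullet_drop_left v j :
  bullet v.+1 i j -> t i.+1 j = Some v.+1 -> kept i v ->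
  bullet v i j.-1 /\ t i.+1 j.-1 = Some v.
Proof.
move=> b tv /andP[/asboolP[j' tj'] nl].
have ej : j' = j.
  have [|jj'] := leqP j' j.
    rewrite leq_eqVlt => /orP[/eqP //|lt].
    case/bullet_initial: b => [Cij|[w wv tw]].
      by case: (C_below tj' Cij (leqnn i) (ltnW lt)).
    by have := t_incr tj' tw (leqnn i) (ltnW lt); lia.
  have [w vw tw] := bullet_above b (in_grid_t tj') (leqnn i) (ltnW jj')
    (ltac:(lia)).
  by move: tw; rewrite tj' => -[]; lia.
subst j'; move: b; rewrite bulletS tj' eqxx /=.
have -> : bullet v i j = false by exact: (no_bullet_above tj').
move=> /= bb; have bl : bullet v i j.-1.
  case/orP: bb => // bu; apply/negPn/negP => nbl.
  by case/asboolP: nl; exists j.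
split=> //.
have g : in_grid i.+1 j.-1.
  apply: grid_convex (bullet_in_grid bl) (in_grid_t tv) _ _; lia.
have [w vw tw] : exists2 w, v <= w & t i.+1 j.-1 = Some w.
  by apply: bullet_adjacent bl g _; left.
have j0 : 0 < j by case: (j) tj' => // /in_grid_t; rewrite grid_col0.
have := t_incr tw tv (leqnn _) (leq_pred j) (ltac:(lia)).
by rewrite tw => ?; congr Some; lia.
Qed.

(** Iterating [bullet_drop_left] until it stops gives the lower end [x] required by [word_gain]. *)
Lemma drop_run_back z j : bullet z i j -> t i.+1 j = Some z ->
  exists x, [/\ x <= z, forall v, x <= v <= z -> row_has i.+1 v,
    forall v, x <= v < z -> kept i v & forall v, v.+1 = x -> ~~ kept i v].
Proof.
elim: z j => [|z IH] j b tz.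
  exists 0; split=> // v.
  by rewrite leqn0 => /eqP->; apply/asboolP; exists j.
have rz : row_has i.+1 z.+1 by apply/asboolP; exists j.
have [kz|nkz] := boolP (kept i z); last first.
  exists z.+1; split=> // v.
  - by move=> vz; have -> : v = z.+1 by lia.
  - lia.
  - by case=> ->.
have [b' tz'] := bullet_drop_left b tz kz.
have [x [xz hL hU hx]] := IH _ b' tz'.
exists x; split=> //; first lia.
- move=> v vz; case: (v =P z.+1) => [->//|]; move=> ne; apply: hL; lia.
- move=> v vz; case: (v =P z) => [->//|]; move=> ne; apply: hU; lia.
Qed.

Variable m : nat.
Hypothesis t_bound : forall i j v, t i j = Some v -> v < m.

Lemma drop_kept_or_gained v j :
  bullet v i j -> t i.+1 j = Some v -> final_row_has i v.
Proof.
move=> b tv; apply/final_rowP; exists j.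
by rewrite settledE b tv eqxx !orbT.
Qed.

(** If [v.+1] is in row [i.+1], it is in the next column and the box above it is forced to contain
    [v]. Both copies of [v] turn into bullets, so [v.+1] has a bullet above it, which continues the
    run, and one on its left, so that it is not lost. *)
Lemma drop_run_fwd v j : bullet v i j -> t i.+1 j = Some v ->
  exists y, [/\ v <= y, forall w, v <= w <= y -> row_has i.+1 w,
    forall w, v < w <= y -> ~~ lost i.+1 w,
    forall w, v <= w <= y -> final_row_has i w & ~~ row_has i.+1 y.+1].
Proof.
move: {2}(m - v) (leqnn (m - v)) => n; elim: n v j => [|n IH] v j hn b tv.
  by have := t_bound tv; lia.
have rv : row_has i.+1 v by apply/asboolP; exists j.
have fv := drop_kept_or_gained b tv.
have [rvS|nrvS] := boolP (row_has i.+1 v.+1); last first.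
  exists v; split=> // w; last 1 first.
  - by move=> vw; have -> : w = v by lia.
  - by move=> vw; have -> : w = v by lia.
  - lia.
have /asboolP[j' tj'] := rvS.
have jj' : j < j'.
  rewrite ltnNge; apply/negP => le; case: (ltngtP j' j) le => // [lt|e] _.
    by have := t_incr tj' tv (leqnn _) (ltnW lt); lia.
  by move: tv; rewrite -e tj' => -[]; lia.
have g : in_grid i.+1 j.+1.
  by apply: grid_convex (in_grid_t tv) (in_grid_t tj') _ _; lia.
have [w tw] : exists w, t i.+1 j.+1 = Some w.
  case/orP: g => [C'|]; first by case: (C_below tv C').
  by case: (t _ _) => // w _; exists w.
have wv := t_incr tv tw (leqnn _) (leqnSn j) (ltac:(lia)).
have ew : w = v.+1.
  case: (ltngtP j.+1 j') => [lt||e]; last 2 first.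
  - lia.
  - by move: tw; rewrite e tj' => -[].
  by have := t_incr tw tj' (leqnn _) (ltnW lt); lia.
subst w.
have g' : in_grid i j.+1.
  by apply: grid_convex (bullet_in_grid b) (in_grid_t tw) _ _; lia.
have [w vw tw'] : exists2 w, v <= w & t i j.+1 = Some w.
  by apply: bullet_adjacent b g' _; right.
have ew : w = v.
  by have := t_incr tw' tw (leqnSn i) (leqnn _) (ltac:(lia)); lia.
subst w.
have b' : bullet v.+1 i j.+1 by rewrite bulletS tw' eqxx /= b orbT.
have bl : bullet v.+1 i.+1 j by rewrite bulletS tv eqxx /= b !orbT.
have [|y [vy hR hl hf hy]] := IH v.+1 j.+1 _ b' tw; first by have := t_bound tv; lia.
exists y; split=> //; first lia.
- by move=> w vwy; case: (w =P v) => [->//|ne]; apply: hR; lia.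
- move=> w vwy; case: (w =P v.+1) => [->|ne]; last by apply: hl; lia.
  by apply/asboolPn => -[j2 [t2 _]]; rewrite (row_inj t2 tw) bl.
- by move=> w vwy; case: (w =P v) => [->//|ne]; apply: hf; lia.
Qed.

Variable a : int.
Local Notation "u ~~ v" := (hecke_equiv (letters a u) (letters a v))
  (at level 70).

(** Intermediate rows, in which only the values at least [s] have been exchanged; [s] decreases from
    [m] to [0]. *)
Let lower s v := row_has i.+1 v && ~~ (lost i.+1 v && (s <= v)).
Let upper s v := kept i v || (gained i v && (s <= v)).

Let two_rows_gain s : s < m ->
  word_of m (lower s.+1) ++ word_of m (upper s.+1) ~~
  word_of m (lower s.+1) ++ word_of m (upper s).
Proof.
move=> sm; have [gs|ngs] := boolP (gained i s); last first.
  suff -> : word_of m (upper s.+1) = word_of m (upper s) by [].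
  apply: eq_filter => v; rewrite /upper; case: (v =P s) => [->|]; last lia.
  by rewrite (negPf ngs).
have -> : word_of m (upper s) = word_of m (fun v => upper s.+1 v || (v == s)).
  apply: eq_filter => v; rewrite /upper; case: (v =P s) => [->|]; last lia.
  by rewrite gs leqnn !orbT.
have /andP[nr /asboolP[j /andP[b /eqP ts]]] := gs.
have [x [xs hL hU hx]] := drop_run_back b ts.
apply: (@word_gain a m _ _ x s) => //.
- move=> v vs; rewrite /lower hL //; lia.
- by move=> v vs; rewrite /upper hU.
(* If [s.+1] were in row [i.+1], the box right of the bullet would contain [s], but a gained value
   is not in row [i] beforehand. *)
- rewrite /lower; apply/nandP; left; apply/asboolPn => -[j' tj'].
  have jj' : j < j'.
    rewrite ltnNge; apply/negP => le; case: (ltngtP j' j) le => // [lt|e] _.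
      by have := t_incr tj' ts (leqnn _) (ltnW lt); lia.
    by move: ts; rewrite -e tj' => -[]; lia.
  have g : in_grid i j.+1.
    by apply: grid_convex (bullet_in_grid b) (in_grid_t tj') _ _; lia.
  have [w sw tw] : exists2 w, s <= w & t i j.+1 = Some w.
    by apply: bullet_adjacent b g _; right.
  have := t_incr tw tj' (leqnSn i) jj' (ltac:(lia)) => wS.
  by case/asboolP: nr; exists j.+1; rewrite tw; congr Some; lia.
- move=> v vx; rewrite /upper (negPf (hx v vx)); lia.
Qed.

Let two_rows_loss s : s < m ->
  word_of m (lower s.+1) ++ word_of m (upper s) ~~
  word_of m (lower s) ++ word_of m (upper s).
Proof.
move=> sm; have [ls|nls] := boolP (lost i.+1 s); last first.
  suff -> : word_of m (lower s.+1) = word_of m (lower s) by [].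
  apply: eq_filter => v; rewrite /lower; case: (v =P s) => [->|]; last lia.
  by rewrite (negPf nls).
have -> : word_of m (lower s) = word_of m (fun v => lower s.+1 v && (v != s)).
  apply: eq_filter => v; rewrite /lower; case: (v =P s) => [->|]; last lia.
  by rewrite ls leqnn !andbF.
have /asboolP[j [ts b nbl]] := ls; rewrite /= in b.
have [y [sy hR hl hf hy]] := drop_run_fwd b ts.
have up w : s <= w <= y -> upper s w.
  move=> wy; have := hf w wy; rewrite /final_row_has /upper.
  by case/andP: wy => ->; rewrite andbT.
have ym : y < m.
  have /asboolP[j' tj'] : row_has i.+1 y by apply: hR; lia.
  exact: t_bound tj'.
apply: (@word_loss a m _ _ s y) => //.
- move=> v vy; rewrite /lower hR //=; case: (v =P s) => [->|ne].
    by rewrite ltnn andbF.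
  by rewrite (negPf (hl v _)) //; lia.
- by move=> v vy; apply: up; lia.
- by rewrite /lower (negPf hy).
(* Were [s - 1] kept in row [i], [bullet_drop_left] would lead to a bullet left of [s] in row
   [i.+1], and [s] would not be lost. *)
- move=> v vs; rewrite /upper; have -> : (s <= v) = false by lia.
  rewrite andbF orbF; apply/negP => kv; subst s.
  have [b' tv] := bullet_drop_left b ts kv.
  by move: nbl; rewrite bulletS tv eqxx /= b' !orbT.
- by apply: up; lia.
Qed.

(** For each [s], the gain of row [i] precedes the loss of row [i.+1], because the loss needs [s] to
    be present in both rows. *)
Lemma two_rows_slide :
  word_of m (row_has i.+1) ++ word_of m (kept i) ~~
  word_of m (kept i.+1) ++ word_of m (final_row_has i).
Proof.
have main n : n <= m -> word_of m (row_has i.+1) ++ word_of m (kept i) ~~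
    word_of m (lower (m - n)) ++ word_of m (upper (m - n)).
  elim: n => [|n IH] nm.
    have -> : word_of m (lower (m - 0)) = word_of m (row_has i.+1).
      apply: eq_in_filter => v; rewrite mem_iota /lower; lia.
    have -> : word_of m (upper (m - 0)) = word_of m (kept i).
      apply: eq_in_filter => v; rewrite mem_iota /upper; lia.
    by [].
  apply: hecke_equiv_trans (IH (ltnW nm)) _.
  have -> : m - n = (m - n.+1).+1 by lia.
  apply: hecke_equiv_trans (two_rows_gain _) (two_rows_loss _); lia.
apply: hecke_equiv_trans (main m (leqnn m)) _; rewrite subnn.
have -> : word_of m (lower 0) = word_of m (kept i.+1).
  by apply: eq_filter => v; rewrite /lower andbT.
have -> : word_of m (upper 0) = word_of m (final_row_has i).
  by apply: eq_filter => v; rewrite /upper andbT.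
by [].
Qed.

End TwoRows.

Definition rows_word (n m : nat) (R : nat -> nat -> bool) : seq nat :=
  flatten [seq word_of m (R r) | r <- rev (iota 1 n)].

Lemma rows_wordS n m R :
  rows_word n.+1 m R = word_of m (R n.+1) ++ rows_word n m R.
Proof.
rewrite /rows_word; have -> : iota 1 n.+1 = rcons (iota 1 n) n.+1.
  by rewrite -cats1 -[in LHS](addn1 n) iotaD.
by rewrite rev_rcons.
Qed.

Theorem grid_slide_word (a : int) (n m : nat) :
  (forall i j v, t i j = Some v -> v < m) ->
  (forall j, t n.+1 j = None) ->
  hecke_equiv (letters a (rows_word n m row_has))
              (letters a (rows_word n m final_row_has)).
Proof.
move=> tm tn.
(* Rows [1] to [k] are already slid; row [k.+1] has given entries to row [k] but has not received
   any yet. For [k = 0] nothing is given, as row 0 is empty. *)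
have main k : hecke_equiv (letters a (rows_word k.+1 m row_has))
    (letters a (word_of m (kept k.+1) ++ rows_word k m final_row_has)).
  elim: k => [|k IH].
    rewrite rows_wordS; suff -> : word_of m (row_has 1) = word_of m (kept 1) by [].
    apply: eq_filter => v; rewrite /kept; suff -> : lost 1 v = false.
      by rewrite andbT.
    by apply/asboolPn => -[j [_ /bullet_in_grid]]; rewrite /= grid_row0.
  rewrite rows_wordS; apply: hecke_equiv_trans (nat_equiv_catl _ IH) _.
  rewrite rows_wordS !catA; apply: nat_equiv_catr.
  exact: two_rows_slide.
have := main n; rewrite rows_wordS.
have empty : forall v, row_has n.+1 v = false.
  by move=> v; apply/asboolPn => -[j]; rewrite tn.
have -> : word_of m (row_has n.+1) = [::].
  by rewrite /word_of (eq_filter empty) filter_pred0.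
have -> : word_of m (kept n.+1) = [::].
  rewrite /word_of (@eq_filter _ _ pred0) ?filter_pred0 // => v.
  by rewrite /kept empty.
by [].
Qed.

End GridSlide.

(** * Slides and doubling *)

Local Open Scope fset_scope.
Local Open Scope fmap_scope.

Lemma leq_sum_eq (p q r s : nat) :
  p <= r -> q <= s -> r + s <= p + q -> p = r /\ q = s.
Proof. lia. Qed.

Lemma box_leE (x y : box) : (x <= y)%O = (x.1 <= y.1) && (x.2 <= y.2).
Proof. by rewrite leEprod !leEnat. Qed.

Lemma box_ltE (x y : box) :
  (x < y)%O = [&& x.1 <= y.1, x.2 <= y.2 & x.1 + x.2 < y.1 + y.2].
Proof.
case: x y => [a b] [c d]; rewrite lt_neqAle box_leE /= xpair_eqE; lia.
Qed.

Lemma coversP (x y : box) : covers x y <->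
  [/\ inDelta x, inDelta y &
      (y = (x.1.+1, x.2)) \/ (y = (x.1, x.2.+1))].
Proof.
case: x y => [a b] [c d]; split.
  case/and4P => dx dy lt /hasPn no; split=> //.
  have none z : inDelta z -> (((a, b) : box) < z)%O -> (z <= ((c, d) : box))%O ->
      z = (c, d).
    move=> dz lz zl; apply/eqP/negPn/negP => ne.
    have := no z; rewrite in_ideal dz zl => /(_ isT).
    by rewrite lz /= lt_neqAle ne zl.
  move: lt dx dy; rewrite box_ltE /inDelta /= => lt dx dy.
  (* If [b < d], a step to the right stays in Delta. Otherwise [a < c <= d = b], and a step down
     does. *)
  have [bd|db] := ltnP b d.
    right; apply/esym/none; rewrite ?box_ltE ?box_leE /inDelta /=; lia.
  left; apply/esym/none; rewrite ?box_ltE ?box_leE /inDelta /=; lia.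
case=> dx dy e; rewrite /covers dx dy /=; apply/andP; split.
  by case: e => -[-> ->]; rewrite box_ltE /=; lia.
apply/hasPn => -[u v] _; rewrite !box_ltE /=.
by case: e => -[-> ->]; lia.
Qed.

(** The box of Delta onto which [(i, j)] and [(j, i)] fold; the doubling of [T] at [(i, j)] is [T]
    at [sort_box i j]. *)
Definition sort_box (i j : nat) : box := (minn i j, maxn i j).

Lemma sort_boxC i j : sort_box i j = sort_box j i.
Proof. by rewrite /sort_box minnC maxnC. Qed.

Lemma sort_box_id (x : box) : x.1 <= x.2 -> sort_box x.1 x.2 = x.
Proof. by case: x => a b /= ab; rewrite /sort_box (minn_idPl ab) (maxn_idPr ab). Qed.

Lemma sort_box_Delta i j : inDelta (sort_box i j) = (0 < i) && (0 < j).
Proof. rewrite /inDelta /=; lia. Qed.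

Lemma sort_box_le i j i' j' : i <= i' -> j <= j' ->
  (sort_box i j <= sort_box i' j')%O.
Proof. by rewrite box_leE /=; lia. Qed.

Lemma sort_box_lt i j i' j' : i <= i' -> j <= j' -> i + j < i' + j' ->
  (sort_box i j < sort_box i' j')%O.
Proof. by rewrite box_ltE /=; lia. Qed.

(** At a diagonal box, the grid neighbors below and on the left lie outside Delta and are replaced
    by their mirror images, [P] being symmetric. Row 0 and column 0 contribute nothing, as [P]
    vanishes there. *)
Lemma neighbor_exists (P : nat -> nat -> bool) (x : box) :
  (forall i j, P i j = P j i) -> (forall j, P 0 j = false) -> inDelta x ->
  (exists y, [/\ inDelta y, neighbor x y & P y.1 y.2]) <-> some_nbr P x.1 x.2.
Proof.
move=> Psym P0; case: x => [a b] dx /=; split.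
  case=> -[c d] [dy + /= Py]; rewrite /some_nbr => /orP[]/coversP[_ _ /=].
    by case=> -[ec ed]; move: Py; rewrite ec ed => ->; rewrite ?orbT.
  by case=> -[-> ->] /=; rewrite Py !orbT.
move: dx; rewrite /inDelta /= => dx.
case/or4P => Pn.
- have [ab|ba] := ltnP a b.
    exists (a.+1, b); split; rewrite ?Pn /inDelta /=; try lia.
    apply/orP; left; apply/coversP; rewrite /inDelta /=; split; try lia.
    by left.
  have e : a = b by lia.
  subst b; exists (a, a.+1); split; rewrite ?[P a _]Psym ?Pn /inDelta /=; try lia.
  apply/orP; left; apply/coversP; rewrite /inDelta /=; split; try lia.
  by right.
- exists (a, b.+1); split; rewrite ?Pn /inDelta /=; try lia.
  apply/orP; left; apply/coversP; rewrite /inDelta /=; split; try lia.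
  by right.
- case: a dx Pn => [|[|a]] dx; rewrite /= ?P0 // => Pn.
  exists (a.+1, b); split; rewrite ?Pn /inDelta /=; try lia.
  apply/orP; right; apply/coversP; rewrite /inDelta /=; split; try lia.
  by left.
case: b dx Pn => [|b] dx /= Pn; first by lia.
have [ab|ba] := ltnP a b.+1.
  exists (a, b); split; rewrite ?Pn /inDelta /=; try lia.
  apply/orP; right; apply/coversP; rewrite /inDelta /=; split; try lia.
  by right.
have e : a = b.+1 by lia.
subst a; case: b dx Pn ba => [|b] dx Pn _; first by rewrite Psym P0 in Pn.
exists (b.+1, b.+2); split; rewrite /= ?[P b.+1 _]Psym ?Pn /inDelta /=; try lia.
apply/orP; right; apply/coversP; rewrite /inDelta /=; split; try lia.
by left.
Qed.

Lemma increasing_fnd (T : tableau) x y u v : increasing T ->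
  T.[? x] = Some u -> T.[? y] = Some v -> (x < y)%O -> (u < v)%R.
Proof.
move=> inc; case: fndP => // xT [<-]; case: fndP => // yT [<-] xy.
exact: (inc [` xT] [` yT]).
Qed.

Lemma fnd_swap (S : choiceType) (s s' : S) (Y : {fmap box -> S}) (x : box) :
  (swap s s' Y).[? x] =
  if (Y.[? x] == Some s) && `[< exists y, neighbor x y /\ Y.[? y] = Some s' >]
  then Some s'
  else if (Y.[? x] == Some s') &&
          `[< exists y, neighbor x y /\ Y.[? y] = Some s >]
  then Some s
  else Y.[? x].
Proof.
have exE c : [exists y : domf Y, neighbor x (val y) && (Y y == c)] =
    `[< exists y, neighbor x y /\ Y.[? y] = Some c >].
  apply/existsP/asboolP => [[y /andP[n /eqP <-]]|[y [n Yy]]].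
    by exists (val y); rewrite Some_fnd.
  move: Yy; case: fndP => // yY [Yy]; exists [` yY].
  by rewrite n Yy eqxx.
case: (boolP (x \in domf Y)) => xY; last first.
  have xS : x \notin domf (swap s s' Y) by [].
  by rewrite (not_fnd xS) (not_fnd xY).
have xS : x \in domf (swap s s' Y) by [].
rewrite (in_fnd xS) (in_fnd xY) ffunE /= !exE.
have -> : Y [` xS] = Y [` xY] by congr (Y _); apply: val_inj.
rewrite !some_eqE.
by case: ifP => // _; case: ifP.
Qed.

Lemma fnd_add_bullets (C : {fset box}) (T : tableau) x :
  (add_bullets C T).[? x] =
  if x \in domf T `|` C then Some T.[? x] else None.
Proof.
case: ifP => xC; last by rewrite not_fnd // /add_bullets xC.
have xS : x \in domf (add_bullets C T) by [].
by rewrite (in_fnd xS) ffunE.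
Qed.

Lemma fnd_doubling (T : tableau) i j : (forall x, x \in domf T -> inDelta x) ->
  (doubling T).[? ((i, j) : box)] = T.[? sort_box i j].
Proof.
move=> dT.
have sE : (if i <= j then (i, j) else transpose (i, j)) = sort_box i j.
  rewrite /sort_box /transpose /=; case: leqP => // ij.
have memE : ((i, j) \in doubled_shape (domf T)) = (sort_box i j \in domf T).
  rewrite /doubled_shape in_fsetU; apply/orP/idP => [[h|/imfsetP[/= x h]]|].
  - have := dT _ h; rewrite /inDelta /= => /andP[_ ij].
    by rewrite -sE ij.
  - case=> -> ->; have := dT _ h; rewrite /inDelta => /andP[_ ij].
    by rewrite sort_boxC sort_box_id.
  - rewrite -sE; case: leqP => ij h; first by left.
    by right; apply/imfsetP; exists (transpose (i, j)).
case: (boolP (sort_box i j \in domf T)) => h; last first.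
  by rewrite (not_fnd h) not_fnd //= memE.
have xS : (i, j) \in domf (doubling T) by rewrite /= memE.
by rewrite (in_fnd xS) ffunE /= sE (in_fnd h).
Qed.

(* The doubling of [T], with the values counted from [a]. *)
Definition shape_grid (T : tableau) (a : int) (i j : nat) : option nat :=
  omap (fun v => `|v - a|%N) T.[? sort_box i j].

(** [row_word] with a freely chosen bound, which tableaux of different shapes can share. *)
Definition grid_word (N : nat) (S : tableau) : seq int :=
  flatten [seq pmap (fun c => S.[? ((r, c) : box)]) (iota 1 N)
          | r <- rev (iota 1 N)].

Lemma row_word_pad (N : nat) (S : tableau) :
  (forall x, x \in domf S -> x.1 <= N /\ x.2 <= N) ->
  row_word S = grid_word N S.
Proof.
move=> hN; rewrite /row_word /grid_word.
set n := \max_(_ <- _) _.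
have nN : n <= N.
  by apply/bigmax_leqP_seq => x xS _; rewrite geq_max; have [-> ->] := hN x xS.
have out r c : (n < r) || (n < c) -> S.[? ((r, c) : box)] = None.
  move=> rc; apply: not_fnd; apply/negP => xS.
  have := leq_bigmax_seq (F := fun x : box => maxn x.1 x.2) (P := xpredT) _ xS isT.
  by rewrite -/n /=; lia.
have none (s : seq nat) (f : nat -> option int) :
    (forall c, c \in s -> f c = None) -> pmap f s = [::].
  by elim: s => //= c s IH H; rewrite H ?mem_head //= IH // => d ds;
    apply: H; rewrite inE ds orbT.
rewrite -(subnKC nN) iotaD rev_cat map_cat flatten_cat.
set hi := flatten [seq _ | _ <- rev (iota (1 + n) _)].
have -> : hi = [::].
  rewrite /hi; set rs := rev _.
  have : forall r, r \in rs -> n < r.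
    by move=> r; rewrite mem_rev mem_iota; lia.
  elim: rs => //= r rs IH H; rewrite IH; last first.
    by move=> q qrs; apply: H; rewrite inE qrs orbT.
  by rewrite none // => c _; rewrite out // H // mem_head.
congr flatten; apply: eq_map => r; rewrite pmap_cat [X in _ ++ X]none ?cats0 //.
by move=> c; rewrite mem_iota => h; apply: out; lia.
Qed.

Lemma sorted_pmap_iota (g : nat -> option int) s n :
  (forall c c' u v, g c = Some u -> g c' = Some v -> c < c' -> (u < v)%R) ->
  sorted (fun u v : int => (u < v)%R) (pmap g (iota s n)).
Proof.
move=> ginc; elim: n s => //= n IH s; case gs: (g s) => [u|] //=.
rewrite path_min_sorted //; apply/allP => v; rewrite mem_pmap => /mapP[c].
by rewrite mem_iota => sc gc; apply: ginc gs (esym gc) _; lia.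
Qed.

(** Row by row, both sides are strictly increasing words with the same letters. *)
Lemma grid_word_rows (S : tableau) (N m : nat) (a : int) :
  (forall r c v, S.[? ((r, c) : box)] = Some v -> 0 < c <= N) ->
  (forall r c c' u v, S.[? ((r, c) : box)] = Some u ->
     S.[? ((r, c') : box)] = Some v -> c < c' -> (u < v)%R) ->
  (forall r c v, S.[? ((r, c) : box)] = Some v ->
     exists2 k, k < m & v = (a + k%:Z)%R) ->
  grid_word N S = letters a (rows_word N m
    (fun r k => `[< exists c, S.[? ((r, c) : box)] = Some (a + k%:Z)%R >])).
Proof.
move=> Spos Sinc Srange; rewrite /grid_word /letters /rows_word map_flatten.
congr flatten; rewrite -map_comp; apply: eq_map => r /=.
apply: (@lt_sorted_eq _ int).
- by apply: sorted_pmap_iota => c c' u v; apply: Sinc.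
- apply: (@homo_sorted _ _ _ ltn) => [u v /= uv|]; first by lia.
  by apply: sorted_filter; [exact: ltn_trans | exact: iota_ltn_sorted].
move=> v; rewrite mem_pmap; apply/mapP/mapP => -[c].
  move=> _ /esym Sv; have [k km kv] := Srange _ _ _ Sv; exists k => //.
  rewrite mem_filter mem_iota km andbT andbT; apply/asboolP; exists c.
  by rewrite Sv kv.
rewrite mem_filter => /andP[/asboolP[c' Sv] _] ->; exists c' => //.
by rewrite mem_iota; have := Spos _ _ _ Sv; lia.
Qed.

(** * Type B slides as slides of the doubled grid *)

Section SlideBridge.
Variables (T : tableau) (nu lam C : {fset box}) (a b : int).
Hypothesis Tskew : skew_shape (domf T) nu lam.
Hypothesis Tincr : increasing T.
Hypothesis Cmax : maximal_boxes lam C.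
Hypothesis ab : (a <= b)%R.
Hypothesis Tab : forall x : domf T, (a <= T x <= b)%R.

Let t := shape_grid T a.
Let Cg i j := sort_box i j \in C.
Let m := `|b - a|%N.+1.

Let tP i j v : t i j = Some v <-> T.[? sort_box i j] = Some (a + v%:Z)%R.
Proof.
rewrite /t /shape_grid; case: fndP => // xT.
rewrite /=; have := Tab [` xT]; move: (T.[xT]) => w wab.
by split=> [[<-]|[->]]; congr Some; lia.
Qed.

Let t_dom i j : (t i j : bool) = (sort_box i j \in domf T).
Proof. by rewrite /t /shape_grid; case: fndP. Qed.

Let t_bound i j v : t i j = Some v -> v < m.
Proof.
move/tP; case: fndP => // xT [e]; have := Tab [` xT]; rewrite e /m; lia.
Qed.

(** A difference of two order ideals, from which convexity of the grid follows. *)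
Let gridE i j :
  in_grid t Cg i j = (sort_box i j \in nu) && (sort_box i j \notin lam `\` C).
Proof.
have [snu slam lnu _] := Tskew; have [Cl _] := Cmax.
rewrite /in_grid t_dom /Cg [domf T](_ : _ = nu `\` lam); last by case: Tskew.
move: (sort_box i j) => x; rewrite !in_fsetD.
have h1 : (x \in C) ==> (x \in lam) by apply/implyP => /(fsubsetP Cl).
have h2 : (x \in lam) ==> (x \in nu) by apply/implyP => /(fsubsetP lnu).
by move: h1 h2; case: (x \in C); case: (x \in lam); case: (x \in nu).
Qed.

Let lamC_straight : straight (lam `\` C).
Proof.
have [_ [ld ll] _ _] := Tskew; have [_ Cm] := Cmax; split.
  by move=> x; rewrite in_fsetD => /andP[_ /ld].
move=> x y; rewrite !in_fsetD => /andP[yC yl] dx xy.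
rewrite (ll x y) // andbT; apply/negP => xC.
have := Cm x y xC yl; rewrite lt_neqAle xy andbT negbK => /eqP e.
by rewrite -e xC in yC.
Qed.

Let Delta_pos i j : in_grid t Cg i j -> (0 < i) && (0 < j).
Proof.
rewrite gridE => /andP[h _]; rewrite -sort_box_Delta.
by have [[nd _] _ _ _] := Tskew; apply: nd.
Qed.

Let grid_convex i j i' j' x y : in_grid t Cg i j -> in_grid t Cg i' j' ->
  i <= x <= i' -> j <= y <= j' -> in_grid t Cg x y.
Proof.
move=> g g' /andP[ix xi] /andP[jy yj].
have dxy : inDelta (sort_box x y).
  by rewrite sort_box_Delta; have := Delta_pos g; lia.
have dij : inDelta (sort_box i j) by rewrite sort_box_Delta Delta_pos.
move: g g'; rewrite !gridE => /andP[_ nl] /andP[hn _].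
have [[_ nuP] _ _ _] := Tskew; have [_ lP] := lamC_straight.
rewrite (nuP _ _ hn dxy (sort_box_le xi yj)) /=.
by apply: contra nl => hl; apply: (lP _ _ hl dij (sort_box_le ix jy)).
Qed.

Let t_incr i j u i' j' v : t i j = Some u -> t i' j' = Some v ->
  i <= i' -> j <= j' -> i + j < i' + j' -> u < v.
Proof.
move=> /tP tu /tP tv ii jj lt.
have := increasing_fnd Tincr tu tv (sort_box_lt ii jj lt); lia.
Qed.

Let C_below i j u i' j' : t i j = Some u -> Cg i' j' -> i <= i' -> j <= j' ->
  False.
Proof.
move=> tu c ii jj; have [Cl _] := Cmax.
have hT : sort_box i j \in domf T by rewrite -t_dom tu.
have [[nd _] [_ ll] _ dE] := Tskew.
have := hT; rewrite dE in_fsetD => /andP[nl hn].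
by rewrite (ll _ _ (fsubsetP Cl _ c) (nd _ hn) (sort_box_le ii jj)) in nl.
Qed.

Let C_antichain i j i' j' : Cg i j -> Cg i' j' -> i <= i' -> j <= j' ->
  i = i' /\ j = j'.
Proof.
move=> c c' ii jj; have [Cl Cm] := Cmax.
have [lt|] := ltnP (i + j) (i' + j'); last by lia.
by have := Cm _ _ c (fsubsetP Cl _ c'); rewrite sort_box_lt.
Qed.

Let grid_row0 j : in_grid t Cg 0 j = false.
Proof. by apply/negP => /Delta_pos. Qed.

Let grid_col0 i : in_grid t Cg i 0 = false.
Proof. by apply/negP => /Delta_pos; rewrite andbF. Qed.

Let state := grid_state t Cg.

Let state_sym k i j : state k i j = state k j i.
Proof.
rewrite /state; elim: k i j => [|k IH] i j /=.
  by rewrite /t /shape_grid /Cg sort_boxC.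
have sn c : some_nbr (fun i j => grid_state t Cg k i j == c) i j =
    some_nbr (fun i j => grid_state t Cg k i j == c) j i.
  rewrite /some_nbr; rewrite (IH i.+1 j) (IH i j.+1) (IH i.-1 j) (IH i j.-1).
  by rewrite !orbA [X in X || _ || _]orbC -!orbA; congr [|| _, _ | _]; rewrite orbC.
by rewrite /swap_grid !sn IH.
Qed.

Let shift := omap (fun k : nat => (a + k%:Z)%R).
Let Y k := foldl (fun Y s => swap (Some s) None Y) (add_bullets C T)
  [seq (a + k%:Z)%R | k <- iota 0 k].

Let Y_Delta k y : (Y k).[? y] != None -> inDelta y.
Proof.
have domE : domf (Y k) = domf T `|` C.
  rewrite /Y; move: (map _ _) => l.
  suff H (Z : {fmap box -> option int}) :
      domf (foldl (fun Y s => swap (Some s) None Y) Z l) = domf Z by rewrite H.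
  by elim: l Z => // s l IHl Z /=; rewrite IHl.
case: fndP => // yY _; move: yY; rewrite domE in_fsetU.
have [[nd _] [ld _] _ dE] := Tskew; have [Cl _] := Cmax.
by case/orP => [|/(fsubsetP Cl)/ld//]; rewrite dE in_fsetD => /andP[_ /nd].
Qed.

(** Slides commute with doubling at every stage: the state is symmetric, so [neighbor_exists]
    matches neighbors in Delta with neighbors in the grid. *)
Let fnd_Y k (x : box) : inDelta x -> (Y k).[? x] = omap shift (state k x.1 x.2).
Proof.
elim: k x => [|k IH] x dx.
  rewrite /Y /= fnd_add_bullets in_fsetU /state /=.
  have xE : sort_box x.1 x.2 = x by apply: sort_box_id; case/andP: dx.
  rewrite /Cg xE; have := t_dom x.1 x.2; rewrite xE => <-.
  case tE: (t x.1 x.2) => [v|] /=.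
    by move/tP: tE; rewrite xE => ->.
  case: ifP => // _; rewrite not_fnd //.
  by rewrite -[X in X \in _]xE -t_dom tE.
have -> : Y k.+1 = swap (Some (a + k%:Z)%R) None (Y k).
  by rewrite /Y -[in LHS](addn1 k) iotaD map_cat foldl_cat.
have eqE (y : box) c : inDelta y ->
    ((Y k).[? y] == Some (shift c)) = (state k y.1 y.2 == Some c).
  move=> dy; rewrite IH //; case: (state k y.1 y.2) c => [[u|]|] [c|] //=.
  by rewrite !some_eqE; apply/eqP/eqP => [|-> //]; lia.
have domY := @Y_Delta k.
have exE c : `[< exists y, neighbor x y /\ (Y k).[? y] = Some (shift c) >] =
    some_nbr (fun i j => state k i j == Some c) x.1 x.2.
  have P0 j : (state k 0 j == Some c) = false.
    apply/negP => /eqP e; have := grid_state_dom t Cg k 0 j.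
    by rewrite -/(state k 0 j) e grid_row0.
  apply/asboolP/idP => [[y [n /eqP e]]|].
    have dy : inDelta y by apply: domY; move/eqP: e => ->.
    apply/(neighbor_exists _ _ dx) => //; first by move=> i j; rewrite state_sym.
    by exists y; rewrite -eqE.
  move/(neighbor_exists _ _ dx) => [||y [dy n]]//.
    by move=> i j; rewrite state_sym.
  by rewrite -eqE // => /eqP e; exists y.
have e0 : ((Y k).[? x] == Some None) = _ := eqE x None dx.
have e1 : ((Y k).[? x] == Some (Some (a + k%:Z)%R)) = _ := eqE x (Some k) dx.
have x0 : `[< exists y, neighbor x y /\ (Y k).[? y] = Some None >] = _ :=
  exE None.
have x1 : `[< exists y, neighbor x y /\
    (Y k).[? y] = Some (Some (a + k%:Z)%R) >] = _ := exE (Some k).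
rewrite fnd_swap e0 e1 x0 x1 IH // /state /= /swap_grid.
by case: ifP => // _; case: ifP.
Qed.

Let T' := jdt a b C T.

Let fnd_jdt i j : T'.[? sort_box i j] = ojoin (omap shift (state m i j)).
Proof.
have -> : T'.[? sort_box i j] = ojoin (Y m).[? sort_box i j].
  exact: fnd_reducef.
have [d|nd] := boolP (inDelta (sort_box i j)).
  rewrite fnd_Y //; congr (ojoin (omap _ _)).
  have [->|->] : sort_box i j = (i, j) \/ sort_box i j = (j, i).
    by rewrite /sort_box; case: leqP; [left | right].
  - by [].
  - exact: state_sym.
have -> : (Y m).[? sort_box i j] = None.
  by apply/eqP; apply: contraNT nd; apply: Y_Delta.
have := grid_state_dom t Cg m i j; rewrite -/state.
have -> : in_grid t Cg i j = false.
  by apply: contraNF nd => /Delta_pos; rewrite sort_box_Delta.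
by case: (state m i j).
Qed.

Let jdt_Delta x : x \in domf T' -> inDelta x.
Proof.
move=> xT; apply: (@Y_Delta m); have : T'.[? x] != None by rewrite (in_fnd xT).
have -> : T'.[? x] = ojoin (Y m).[? x] by exact: fnd_reducef.
by case: ((Y m).[? x]).
Qed.

Let jdt_val i j v : T'.[? sort_box i j] = Some v <->
  exists2 k, settled t Cg k i j & k < m /\ v = (a + k%:Z)%R.
Proof.
rewrite fnd_jdt; split=> [|[k sk [km ->]]]; last first.
  have /eqP e : state m i j == Some (Some k).
    by rewrite /state (grid_state_final t Cg _ _ km).
  by rewrite e.
case sE: (state m i j) => [[k|]|] //= [<-].
have km : k < m.
  rewrite ltnNge; apply/negP => mk.
  have /esym := grid_state_initial t Cg i j mk; rewrite -/(state m i j) sE eqxx.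
  by move/eqP/t_bound; lia.
by exists k => //; rewrite -(grid_state_final t Cg _ _ km) -/(state _ _ _) sE.
Qed.

(** A box strictly beyond a remaining bullet would have an entry at least [m] by [bullet_above]. *)
Let no_final_bullet_below i j i' j' : bullet t Cg m i j -> in_grid t Cg i' j' ->
  i <= i' -> j <= j' -> ~~ (i + j < i' + j').
Proof.
move=> b' g ii jj; apply/negP => lt.
have [v mv /t_bound] := bullet_above t_incr grid_convex C_below C_antichain
  b' g ii jj lt.
lia.
Qed.

Let jdt_domE i j : (sort_box i j \in domf T') =
  in_grid t Cg i j && ~~ bullet t Cg m i j.
Proof.
rewrite -(grid_state_dom t Cg m i j) /bullet -/(state m i j).
have -> : (sort_box i j \in domf T') = (T'.[? sort_box i j] : bool).
  by case: fndP.
by rewrite fnd_jdt; case: (state m i j) => [[k|]|].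
Qed.

(** The outer shape loses the boxes that end up with a bullet, which are maximal by
    [no_final_bullet_below]. *)
Lemma jdt_skew_shape : exists nu', skew_shape (domf T') nu' (lam `\` C).
Proof.
pose nu' := [fset x in nu | ~~ bullet t Cg m x.1 x.2].
have [[nd nl] [_ ll] lnu _] := Tskew.
have nuE x : x \in nu' = (x \in nu) && ~~ bullet t Cg m x.1 x.2.
  by rewrite !inE.
have srt x : x \in nu -> sort_box x.1 x.2 = x.
  by move=> /nd/andP[_ h]; apply: sort_box_id.
exists nu'; split.
- split=> [x|x y]; rewrite !nuE; first by case/andP => /nd.
  case/andP => yn yb dx xy; have xn : x \in nu by apply: nl xy.
  rewrite xn; apply/negP => xb; move: xy; rewrite box_leE => /andP[x1 x2].
  have gy : in_grid t Cg y.1 y.2.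
    rewrite gridE srt // yn /=.
    have := bullet_in_grid xb; rewrite gridE srt // xn /=; apply: contra => yl.
    by apply: (proj2 lamC_straight _ _ yl) => //; rewrite box_leE x1.
  have := no_final_bullet_below xb gy x1 x2; rewrite -leqNgt => le.
  have [e1 e2] := leq_sum_eq x1 x2 le.
  by rewrite -e1 -e2 xb in yb.
- exact: lamC_straight.
- apply/fsubsetP => x xl; rewrite nuE.
  have xn : x \in nu.
    by apply: (fsubsetP lnu); move: xl; rewrite in_fsetD => /andP[].
  rewrite xn; apply/negP => /bullet_in_grid.
  by rewrite gridE srt // xl andbF.
apply/fsetP => x; rewrite in_fsetD nuE.
have [d|nd'] := boolP (inDelta x); last first.
  have -> : x \in domf T' = false by apply: contraNF nd'; apply: jdt_Delta.
  have -> : x \in nu = false by apply: contraNF nd' => /nd.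
  by rewrite andbF.
have xE : sort_box x.1 x.2 = x by apply: sort_box_id; case/andP: d.
by rewrite -[in LHS]xE jdt_domE gridE xE -andbA andbCA.
Qed.

Lemma jdt_increasing : increasing T'.
Proof.
move=> [x xT] [y yT] /= xy.
have dx := jdt_Delta xT; have dy := jdt_Delta yT.
have xE : sort_box x.1 x.2 = x by apply: sort_box_id; case/andP: dx.
have yE : sort_box y.1 y.2 = y by apply: sort_box_id; case/andP: dy.
have := in_fnd yT; rewrite -[X in _.[? X] = _]yE => /jdt_val[k sk [km ->]].
have := in_fnd xT; rewrite -[X in _.[? X] = _]xE => /jdt_val[k' sk' [km' ->]].
move: xy; rewrite box_ltE => /and3P[x1 x2 lt].
have gx : in_grid t Cg x.1 x.2.
  by have := xT; rewrite -[X in X \in _]xE jdt_domE => /andP[].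
have st : grid_state t Cg m y.1 y.2 = Some (Some k).
  by apply/eqP; rewrite (grid_state_final t Cg _ _ km).
have [k2 k2k] := settled_incr t_incr grid_convex C_below C_antichain st km gx x1 x2 lt.
move/eqP; have k2m : k2 < m by lia.
move: sk'; rewrite -(grid_state_final t Cg _ _ km') => /eqP-> /eqP[e].
by rewrite e; lia.
Qed.

Let N := \max_(x <- nu) maxn x.1 x.2.

Let bound_N i j : sort_box i j \in nu -> (0 < i <= N) && (0 < j <= N).
Proof.
move=> h; have [[nd _] _ _ _] := Tskew.
have := nd _ h; rewrite sort_box_Delta.
have := leq_bigmax_seq (F := fun x : box => maxn x.1 x.2) (P := xpredT) _ h isT.
by rewrite -/N /=; lia.
Qed.

Let row_word_doubling (S : tableau) : {subset domf S <= nu} -> increasing S ->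
  (forall i j v, S.[? sort_box i j] = Some v ->
     exists2 k, k < m & v = (a + k%:Z)%R) ->
  row_word (doubling S) = letters a (rows_word N m
    (fun r k => `[< exists c, S.[? sort_box r c] = Some (a + k%:Z)%R >])).
Proof.
move=> Snu Sinc Srange; have [[nd _] _ _ _] := Tskew.
have dS x : x \in domf S -> inDelta x by move/Snu/nd.
have dbl i j := fnd_doubling i j dS.
have inS i j v : S.[? sort_box i j] = Some v -> sort_box i j \in nu.
  by case: fndP => // h _; apply: Snu.
rewrite (@row_word_pad N); last first.
  move=> [i j] /= h; have := etrans (esym (dbl i j)) (in_fnd h).
  by move=> /inS/bound_N/andP[/andP[_ ->] /andP[_ ->]].
rewrite (@grid_word_rows _ _ m a).
- congr (letters a (rows_word N m _)); apply/funext => r; apply/funext => k.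
  by congr asbool; apply/propext; split=> -[c]; rewrite ?dbl => h; exists c; rewrite ?dbl.
- by move=> r c v; rewrite dbl => /inS/bound_N; lia.
- move=> r c c' u v; rewrite !dbl => Su Sv cc.
  apply: (increasing_fnd Sinc Su Sv); apply: sort_box_lt => //; lia.
- by move=> r c v; rewrite dbl => /Srange.
Qed.

Lemma jdt_hecke_word :
  hecke_word id (row_word (doubling T)) = hecke_word id (row_word (doubling T')).
Proof.
have [_ _ _ dE] := Tskew.
rewrite !row_word_doubling.
- have -> : (fun r k => `[< exists c, T.[? sort_box r c] = Some (a + k%:Z)%R >])
      = row_has t.
    apply/funext => r; apply/funext => k; congr asbool; apply/propext.
    by split=> -[c /tP]; exists c.
  have -> : (fun r k => `[< exists c, T'.[? sort_box r c] = Some (a + k%:Z)%R >])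
      = (fun r k => (k < m) && final_row_has t Cg r k).
    apply/funext => r; apply/funext => k; apply/asboolP/idP.
      case=> c /jdt_val[k' sk [km e]]; have -> : k = k' by lia.
      by rewrite km; apply/final_rowP => //; exists c.
    case/andP => km /final_rowP[] // c sk; exists c.
    by apply/jdt_val; exists k.
  rewrite (grid_slide_word t_incr grid_convex C_below C_antichain grid_row0
    grid_col0 a (n := N) t_bound).
    congr (hecke_word _ (letters a (flatten _))); apply: eq_map => r.
    by apply: eq_in_filter => k; rewrite mem_iota => /andP[_ ->].
  move=> j; case tE: (t _ _) => [v|] //; have : t N.+1 j by rewrite tE.
  by rewrite t_dom dE in_fsetD => /andP[_ /bound_N]; lia.
- move=> x xT; have d := jdt_Delta xT; have xE : sort_box x.1 x.2 = x.
    by apply: sort_box_id; case/andP: d.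
  by move: xT; rewrite -xE jdt_domE gridE => /andP[/andP[]].
- exact: jdt_increasing.
- by move=> i j v /jdt_val[k _ [km ->]]; exists k.
- by move=> x; rewrite dE in_fsetD => /andP[].
- exact: Tincr.
- move=> i j v Tv; have := Tv; case: fndP => // h [e].
  exists `|v - a|%N; have := Tab [` h]; rewrite e /m; lia.
Qed.

End SlideBridge.

(** * Minimal tableaux *)

Lemma heightE (r c : nat) : inDelta (r, c) -> height (r, c) = r + c - 1.
Proof.
rewrite {1}/inDelta /= => /andP[r0 rc]; apply/eqP; rewrite eqn_leq.
apply/andP; split.
  (* On a chain the coordinate sum is injective, with values from [2] to [r + c]. *)
  apply/bigmax_leqP_seq => S; rewrite fpowersetE => /fsubsetP Sx /andP[_ /allrelP ch].
  have card : size [seq (y.1 + y.2)%N | y <- S] = #|` S| by rewrite size_map.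
  rewrite -card -(size_iota 2 (r + c - 1)); apply: uniq_leq_size.
    rewrite map_inj_in_uniq ?fset_uniq // => x y xS yS e.
    have := ch _ _ xS yS; rewrite /Order.comparable !box_leE.
    case: x y e {xS yS} => [x1 x2] [y1 y2] /= e h.
    have [-> ->] : x1 = y1 /\ x2 = y2 by lia.
    by [].
  move=> n /mapP[[y1 y2] yS ->]; have := Sx _ yS.
  by rewrite in_ideal box_leE /inDelta mem_iota /=; lia.
(* A longest chain follows the first row to column [c] and then goes down to row [r]. *)
pose S := [fset y in ideal (r, c) | (y.1 == 1) || (y.2 == c)].
have SE y : (y \in S) = (y \in ideal (r, c)) && ((y.1 == 1) || (y.2 == c)).
  by rewrite !inE.
pose L := [seq ((1, k) : box) | k <- iota 1 c]
  ++ [seq ((k, c) : box) | k <- iota 2 (r - 1)].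
have LS : {subset L <= S}.
  move=> y; rewrite mem_cat SE in_ideal box_leE /inDelta.
  by case/orP => /mapP[k]; rewrite mem_iota => kP -> /=; rewrite ?eqxx; lia.
have -> : r + c - 1 = size L by rewrite size_cat !size_map !size_iota; lia.
apply: (@leq_trans #|` S|).
  apply: uniq_leq_size LS; rewrite cat_uniq !map_inj_uniq ?iota_uniq /=.
  - rewrite andbT; apply/hasPn => y /mapP[k]; rewrite mem_iota => kP ->.
    by apply/negP => /mapP[l _ [e _]]; move: kP; rewrite e.
  - by move=> k l [].
  - by move=> k l [].
apply: (leq_bigmax_seq (F := fun S : {fset box} => #|` S|)).
  by rewrite fpowersetE; apply/fsubsetP => y; rewrite SE => /andP[].
rewrite SE in_ideal lexx /inDelta /= r0 rc eqxx orbT /=.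
apply/allrelP => y z; rewrite !SE !in_ideal !box_leE /Order.comparable /= !box_leE.
rewrite /inDelta; case: y z => [y1 y2] [z1 z2] /=; lia.
Qed.

Lemma fnd_minimal (lam : {fset box}) i j : straight lam ->
  (minimal_tableau lam).[? sort_box i j] =
  if sort_box i j \in lam then Some (Posz (i + j - 1)) else None.
Proof.
move=> [ld _]; case: ifP => h; last by rewrite not_fnd // /minimal_tableau h.
have hM : sort_box i j \in domf (minimal_tableau lam) by [].
rewrite (in_fnd hM) ffunE /= heightE; last exact: ld.
by congr (Some (Posz _)); lia.
Qed.

(** * The action of a run of consecutive letters *)

Definition run (t : int) (n : nat) : seq int :=
  [seq (t + k%:Z)%R | k <- iota 0 n].

(** The value [t] is smaller than everything to its right, so each letter moves it one position
    further and the value it passes one position back. *)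
Lemma run_action (g : int -> int) (t : int) (n : nat) (x : int) : g t = t ->
  (forall y, t < y -> t < g y)%R ->
  hecke_word g (run t n) x =
  if (t <= x < t + n%:Z)%R then g (x + 1)%R
  else if x == (t + n%:Z)%R then t else g x.
Proof.
move=> gt g_gt; elim: n x => [|n IH] x.
  by rewrite /=; repeat case: ifP; move=> *; try lia;
    rewrite -[RHS]gt; congr (g _); lia.
have -> : run t n.+1 = run t n ++ [:: (t + n%:Z)%R].
  by rewrite /run -[in LHS](addn1 n) iotaD map_cat.
have at_top : hecke_word g (run t n) (t + n%:Z)%R = t.
  by rewrite IH; int_cases.
have above_top : hecke_word g (run t n) (t + n%:Z + 1)%R = g (t + n%:Z + 1)%R.
  by rewrite IH; int_cases.
have g1 := g_gt (t + n%:Z + 1)%R (ltac:(lia)).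
rewrite hecke_word_cat /= /sort_at at_top above_top.
rewrite (max_idPr (ltW g1)) (min_idPl (ltW g1)) IH.
case: (x =P (t + n%:Z)%R) => [->|nx]; first by int_cases.
by int_cases.
Qed.

Lemma hecke_word_low (g : int -> int) (l : seq int) (p x : int) :
  {in l, forall y, p <= y}%R -> (x < p)%R -> hecke_word g l x = g x.
Proof.
elim: l g => //= a l IH g lp xp; rewrite IH // => [|y yl]; last first.
  by apply: lp; rewrite inE yl orbT.
have pa : (p <= a)%R by apply: lp; rewrite mem_head.
rewrite /sort_at; int_cases.
Qed.

Lemma hecke_word_high (g : int -> int) (l : seq int) (p : int) :
  {in l, forall y, p <= y}%R -> (forall x, p <= x -> p <= g x)%R ->
  forall x, (p <= x -> p <= hecke_word g l x)%R.
Proof.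
elim: l g => //= a l IH g lp gp; apply: IH => [y yl|x px].
  by apply: lp; rewrite inE yl orbT.
have pa : (p <= a)%R by apply: lp; rewrite mem_head.
have h1 := gp a pa; have h2 := gp (a + 1)%R (ltac:(lia)); have h3 := gp x px.
rewrite /sort_at; int_cases.
Qed.

(** Takes the maximal run starting at [t]. As the letter [t + k] is missing, the tail does not act
    on position [t + k]. *)
Lemma run_prefix (l : seq int) (t : int) :
  sorted (fun u v : int => (u < v)%R) l -> {in l, forall y, t <= y}%R ->
  exists k tl, l = run t k ++ tl /\ {in tl, forall y, t + k%:Z + 1 <= y}%R.
Proof.
elim: l t => [|a l IH] t sl lt; first by exists 0, [::].
have ta : (t <= a)%R by apply: lt; rewrite mem_head.
have al : {in l, forall y, a + 1 <= y}%R.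
  move=> y yl; have := order_path_min lt_trans sl.
  by move=> /allP /(_ y yl); lia.
have [ea|na] := eqVneq a t; last first.
  exists 0, (a :: l); split=> // y; rewrite inE => /orP[/eqP->|/al]; lia.
subst a; have [k [tl [e h]]] := IH (t + 1)%R (path_sorted sl) al.
exists k.+1, tl; split; last by move=> y /h; lia.
rewrite e /run /= addr0; congr (_ :: (_ ++ _)).
rewrite (iotaDl 1 0) -map_comp; apply: eq_map => i /=; lia.
Qed.

(* The word of the [d] rows [N, N - 1, ..., N + 1 - d], in this order. *)
Definition rows_from (N : nat) (l : nat -> seq int) (d : nat) : seq int :=
  flatten [seq l r | r <- rev (iota (N.+1 - d) d)].

Lemma rows_fromS N l d : d < N ->
  rows_from N l d.+1 = rows_from N l d ++ l (N - d).
Proof.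
move=> dN; rewrite /rows_from subSS.
have -> : iota (N - d) d.+1 = (N - d) :: iota (N.+1 - d) d by rewrite /= subSn // ltnW.
by rewrite rev_cons map_rcons flatten_rcons.
Qed.

Section RowsFrom.
Variables (N : nat) (l : nat -> seq int).
Hypothesis l_ge : forall r, 0 < r <= N -> {in l r, forall y, r%:Z <= y}%R.

Let G d := hecke_word id (rows_from N l d).

Lemma rows_from_fix d x : d <= N -> (x < (N.+1 - d)%:Z)%R -> G d x = x.
Proof.
move=> dN xd; rewrite /G; elim: d dN xd => [|d IH] dN xd; first by [].
rewrite rows_fromS // hecke_word_cat.
rewrite (@hecke_word_low _ _ (N - d)%:Z) ?IH //; try lia.
by apply: l_ge; lia.
Qed.

Lemma rows_from_high d x : d <= N -> ((N.+1 - d)%:Z <= x)%R ->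
  ((N.+1 - d)%:Z <= G d x)%R.
Proof.
move=> dN xd; rewrite /G; elim: d x dN xd => [|d IH] x dN xd; first by [].
rewrite rows_fromS // hecke_word_cat.
apply: hecke_word_high => [||//].
  by move=> y yl; have := @l_ge (N - d) (ltac:(lia)) y yl; lia.
move=> y yd; have [yd'|] := leP (N.+1 - d)%:Z%R y.
  by have := IH y (ltnW dN) yd'; lia.
by move=> yd'; have := rows_from_fix (ltnW dN) yd'; rewrite /G => ->.
Qed.

End RowsFrom.

(** * Rows of minimal tableaux and their cancellation *)

Section MinimalRows.
Variables (N : nat) (mu : nat -> nat).
Hypothesis mu_decr : forall r, 0 < r -> mu r.+1 <= mu r.

Let lM r := run r%:Z (mu r).
Let GM d := hecke_word id (rows_from N lM d).

Lemma run_ge t n : {in run t n, forall y, t <= y}%R.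
Proof. by move=> y /mapP[k _ ->]; lia. Qed.

Let lM_ge r : 0 < r <= N -> {in lM r, forall y, r%:Z <= y}%R.
Proof. by move=> _; apply: run_ge. Qed.

(** Provides the hypotheses of [run_action] for the next row, [N - d]. *)
Lemma minimal_rows_step (l : nat -> seq int) d :
  (forall r, 0 < r <= N -> {in l r, forall y, r%:Z <= y}%R) -> d < N ->
  let g := hecke_word id (rows_from N l d) in
  g (N - d)%:Z%R = (N - d)%:Z%R /\
  (forall y, (N - d)%:Z < y -> (N - d)%:Z < g y)%R.
Proof.
move=> l_ge dN g; split; first by apply: rows_from_fix => //; lia.
move=> y yd; have := @rows_from_high N l l_ge d y (ltnW dN) (ltac:(lia)).
by rewrite -/g; lia.
Qed.

(** Row [r] puts the value [r] at position [r + mu r], below all values further right, and changes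
    nothing beyond. By [mu_decr], the previous threshold [r + 1 + mu r.+1] is at most
    [r + mu r + 1]. *)
Lemma minimal_rows_increasing d (x : int) : d <= N ->
  ((N.+1 - d)%:Z + (mu (N.+1 - d))%:Z <= x)%R -> (GM d x < GM d (x + 1))%R.
Proof.
rewrite /GM; elim: d x => [|d IH] x dN xd; first by rewrite /=; lia.
rewrite subSS in xd.
rewrite rows_fromS // hecke_word_cat.
have [gt g_gt] := minimal_rows_step lM_ge dN.
rewrite !run_action //.
have md := @mu_decr (N - d) (ltac:(lia)).
have eS : (N - d).+1 = N.+1 - d by lia.
rewrite eS in md.
have g1 := g_gt (x + 1)%R (ltac:(lia)).
have [e|ne] := eqVneq x ((N - d)%:Z + (mu (N - d))%:Z)%R; first by int_cases.
have := IH x (ltnW dN) (ltac:(lia)).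
int_cases.
Qed.

Lemma minimal_rows_unique (l : nat -> seq int) :
  (forall r, 0 < r <= N -> {in l r, forall y, r%:Z <= y}%R) ->
  (forall r, sorted (fun u v : int => (u < v)%R) (l r)) ->
  hecke_word id (rows_from N l N) = GM N -> forall r, 0 < r <= N -> l r = lM r.
Proof.
move=> l_ge l_sorted eN.
suff main d : d <= N -> hecke_word id (rows_from N l d) = GM d ->
    forall r, N - d < r <= N -> l r = lM r.
  by move=> r rN; apply: (main N) => //; lia.
elim: d => [|d IH] dN e r rd; first by lia.
move: e; rewrite /GM !rows_fromS // !hecke_word_cat => e.
have [gt g_gt] := minimal_rows_step lM_ge dN.
have [gt' g_gt'] := minimal_rows_step l_ge dN.
set g := hecke_word id (rows_from N lM d) in e gt g_gt.
set g' := hecke_word id (rows_from N l d) in e gt' g_gt'.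
have [k [tl [lE tl_ge]]] := run_prefix (l_sorted (N - d)) (@l_ge (N - d) (ltac:(lia))).
set t := (N - d)%:Z%R in e gt g_gt gt' g_gt' lE tl_ge.
(* In [l], the run carries [t] to position [t + k], which the tail does not reach. *)
have vT : hecke_word g (lM (N - d)) (t + k%:Z)%R = t.
  rewrite -e lE hecke_word_cat (hecke_word_low _ tl_ge); last by lia.
  by rewrite run_action //; int_cases.
(* On the minimal side, among the positions from [t] on, only [t + mu (N - d)] has value [t]. *)
have kE : k = mu (N - d).
  move: vT; rewrite run_action // -/t; case: ifP => h1.
    by have := g_gt (t + k%:Z + 1)%R (ltac:(lia)); lia.
  case: eqP => [|ne]; first by lia.
  by have := g_gt (t + k%:Z)%R (ltac:(lia)); lia.
subst k.
(* A last letter [a] of the tail would leave the value at [a] no smaller than the one at [a + 1],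
   against [minimal_rows_increasing]. *)
have tl0 : tl = [::].
  case/lastP: tl lE tl_ge => // tl a lE tl_ge.
  have ha := tl_ge a (ltac:(by rewrite mem_rcons mem_head)).
  have := @minimal_rows_increasing d.+1 a dN; rewrite /GM rows_fromS //.
  rewrite hecke_word_cat -/g subSS -e lE -cats1 catA hecke_word_cat /= => inc.
  have := inc (ltac:(lia)); rewrite /sort_at eqxx.
  by int_cases.
have lrE : l (N - d) = lM (N - d) by rewrite lE tl0 cats0.
(* Cancels the row: by [run_action], [g x] can be read off from the result at [x] or at [x - 1]. *)
have gg : g' = g.
  apply/funext => x; have := congr1 (fun h => h (x - 1)%R) e.
  have := congr1 (fun h => h x) e; rewrite lrE /= !run_action // -/t.
  have -> : (x - 1 + 1)%R = x by lia.
  have [xt|xt|->] := ltgtP x t; last by rewrite gt gt'.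
    by int_cases.
  by int_cases.
have [er|nr] := eqVneq r (N - d); first by rewrite er.
by apply: IH; rewrite ?(ltnW dN) ?gg //; lia.
Qed.

End MinimalRows.

Lemma down_false (P : nat -> bool) s c :
  (forall c, s <= c -> P c.+1 -> P c) -> ~~ P s -> s <= c -> ~~ P c.
Proof.
move=> Pd Ps /subnKC <-; elim: (c - s) => [|k IH]; first by rewrite addn0.
by rewrite addnS; apply: contra IH; apply: Pd; lia.
Qed.

(** [pmap] forgets positions, but a function defined on an initial segment can be recovered from the
    list of its values. *)
Lemma pmap_iota_inj (g g' : nat -> option int) s n :
  (forall c, s <= c -> g c.+1 -> g c) -> (forall c, s <= c -> g' c.+1 -> g' c) ->
  pmap g (iota s n) = pmap g' (iota s n) ->
  forall c, s <= c < s + n -> g c = g' c.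
Proof.
have none (f : nat -> option int) k :
    (forall c, k <= c -> f c.+1 -> f c) -> f k = None ->
    forall c, k <= c -> f c = None.
  move=> fd fk c kc; have := @down_false (fun c => f c : bool) k c fd.
  by rewrite fk => /(_ isT kc); case: (f c).
have nil (f : nat -> option int) k m : (forall c, k <= c -> f c = None) ->
    pmap f (iota k m) = [::].
  by elim: m k => //= m IH k h; rewrite h //= IH // => c kc; apply: h; lia.
elim: n s => [|n IH] s gd gd' e c cn; first by lia.
have gdS c' : s.+1 <= c' -> g c'.+1 -> g c' by move=> sc; apply: gd; lia.
have gdS' c' : s.+1 <= c' -> g' c'.+1 -> g' c' by move=> sc; apply: gd'; lia.
have sc : s <= c by lia.
case gs: (g s) => [u|]; case gs': (g' s) => [u'|]; move: e; rewrite /= gs gs' /=.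
- case=> eu e; have [<-|ne] := eqVneq s c; first by rewrite gs gs' eu.
  by apply: (IH s.+1 gdS gdS' e c); lia.
- by rewrite (nil g') // => d sd; apply: (none g' s) => //; lia.
- by rewrite (nil g) // => d sd; apply: (none g s) => //; lia.
- by move=> _; rewrite (none g s) // (none g' s).
Qed.

Lemma pmap_iota_prefix (P : nat -> bool) (h : nat -> int) s n :
  (forall c, s <= c -> P c.+1 -> P c) ->
  pmap (fun c => if P c then Some (h c) else None) (iota s n)
  = [seq h c | c <- iota s (count P (iota s n))].
Proof.
elim: n s => [//|n IH] s Pd /=.
have Pd' c : s.+1 <= c -> P c.+1 -> P c by move=> sc; apply: Pd; lia.
case Ps: (P s) => /=; first by rewrite IH.
have -> : count P (iota s.+1 n) = 0.
  apply/eqP; rewrite -leqn0 leqNgt -has_count; apply/hasPn => c.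
  rewrite mem_iota => /andP[sc _]; apply: (down_false Pd _ (ltnW sc)).
  by rewrite Ps.
rewrite IH // (_ : count P _ = 0) //.
apply/eqP; rewrite -leqn0 leqNgt -has_count; apply/hasPn => c.
rewrite mem_iota => /andP[sc _]; apply: (down_false Pd _ (ltnW sc)).
by rewrite Ps.
Qed.

(** * Doublings of tableaux of straight shape *)

Section StraightGrid.
Variables (U : tableau) (N : nat).
Hypothesis Ustraight : straight (domf U).
Hypothesis Uincr : increasing U.
Hypothesis Ubound : forall x, x \in domf U -> x.1 <= N /\ x.2 <= N.

Definition straight_row r : seq int := pmap (fun c => U.[? sort_box r c]) (iota 1 N).

Lemma straight_fnd_le i j i' j' : 0 < i -> 0 < j -> i <= i' -> j <= j' ->
  U.[? sort_box i' j'] -> U.[? sort_box i j].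
Proof.
move=> i0 j0 ii jj h.
have hU : sort_box i' j' \in domf U by move: h; case: fndP.
have : sort_box i j \in domf U.
  by apply: (proj2 Ustraight _ _ hU); rewrite ?sort_box_Delta ?i0 ?sort_box_le.
by case: fndP.
Qed.

Lemma straight_row_word : row_word (doubling U) = rows_from N straight_row N.
Proof.
have dbl i j := fnd_doubling i j (proj1 Ustraight).
rewrite (@row_word_pad N); last first.
  move=> [i j] h; have := etrans (esym (dbl i j)) (in_fnd h).
  by case: fndP => // hU _; have /= := Ubound hU; lia.
rewrite /grid_word /rows_from subSnn; congr flatten; apply: eq_map => r.
by apply: eq_pmap => c; apply: dbl.
Qed.

Lemma straight_row_sorted r : sorted (fun u v : int => (u < v)%R) (straight_row r).
Proof.
apply: sorted_pmap_iota => c c' u v Uu Uv cc.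
by apply: (increasing_fnd Uincr Uu Uv); apply: sort_box_lt => //; lia.
Qed.

(** Each step down a column of the doubling raises the entry, starting from at least [u0] in the
    first row. *)
Lemma straight_entry_ge u0 r c v : U.[? sort_box 1 1] = Some u0 -> 0 < r -> 0 < c ->
  U.[? sort_box r c] = Some v -> (u0 + r%:Z - 1 <= v)%R.
Proof.
move=> U0; elim: r v => [//|[|r] IH] v _ c0 Uv.
  have [e|c1] := eqVneq c 1; first by move: Uv; rewrite e U0 => -[<-]; lia.
  have := increasing_fnd Uincr U0 Uv (sort_box_lt _ _ _); lia.
have : U.[? sort_box r.+1 c] by apply: (@straight_fnd_le _ _ r.+2 c) => //; rewrite Uv.
case Uw: (U.[? sort_box r.+1 c]) => [w|//] _.
have h1 := IH w isT c0 Uw.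
have := increasing_fnd Uincr Uw Uv (sort_box_lt _ _ _); lia.
Qed.

Lemma straight_row_mem r v : v \in straight_row r ->
  exists2 c, 0 < c & U.[? sort_box r c] = Some v.
Proof.
rewrite mem_pmap => /mapP[c]; rewrite mem_iota => /andP[c0 _] e.
by exists c.
Qed.

End StraightGrid.

(** * Uniqueness of rectifications *)

Lemma minimal_increasing lam : straight lam -> increasing (minimal_tableau lam).
Proof.
move=> [ld _] [x xl] [y yl] /= xy; rewrite !ffunE /=.
have := ld _ xl; have := ld _ yl; move: xy; rewrite box_ltE.
case: x y {xl yl} => [x1 x2] [y1 y2] /= lt dy dx; rewrite !heightE //.
by move: dx dy; rewrite /inDelta /=; lia.
Qed.

Lemma minimal_increasing_tableau lam :
  straight lam -> increasing_tableau (minimal_tableau lam).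
Proof.
move=> sl; split; last exact: minimal_increasing.
exists lam, fset0; split=> //.
- by rewrite [RHS]fsetD0.
Qed.

Lemma eq_rows_from N l l' d : d <= N ->
  (forall r, 0 < r <= N -> l r = l' r) -> rows_from N l d = rows_from N l' d.
Proof.
move=> dN e; congr flatten; apply/eq_in_map => r.
by rewrite mem_rev mem_iota => h; apply: e; lia.
Qed.

Lemma rows_from_all N l d (P : int -> Prop) : d <= N ->
  (forall r y, N.+1 - d <= r -> r <= N -> y \in l r -> P y) ->
  forall y, y \in rows_from N l d -> P y.
Proof.
move=> dN h y /flattenP[s /mapP[r]]; rewrite mem_rev mem_iota => hr -> yl.
apply: (h r) => //; lia.
Qed.

Section Minimal.
Variables (lam : {fset box}) (N : nat).
Hypothesis lam_straight : straight lam.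

Definition row_length r := count (fun c => sort_box r c \in lam) (iota 1 N).

Lemma row_length_decr r : 0 < r -> row_length r.+1 <= row_length r.
Proof.
move=> r0; have [ld ll] := lam_straight.
rewrite /row_length -!size_filter.
apply: uniq_leq_size; first by rewrite filter_uniq ?iota_uniq.
move=> c; rewrite !mem_filter mem_iota => /andP[h cN]; rewrite cN andbT.
apply: (ll _ _ h); last exact: sort_box_le.
by rewrite sort_box_Delta r0; case/andP: cN => ->.
Qed.

Lemma minimal_row r : 0 < r ->
  straight_row (minimal_tableau lam) N r = run r%:Z (row_length r).
Proof.
move=> r0; have [ld ll] := lam_straight.
rewrite /straight_row (eq_pmap (fun c => fnd_minimal r c lam_straight)).
rewrite (@pmap_iota_prefix (fun c => sort_box r c \in lam)
  (fun c => Posz (r + c - 1))).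
  rewrite /run (iotaDl 1 0) -map_comp; apply: eq_map => c /=; lia.
move=> c c1 h; apply: (ll _ _ h); last exact: sort_box_le.
by rewrite sort_box_Delta r0 c1.
Qed.

End Minimal.

Theorem straight_hecke_unique (lam : {fset box}) (U : tableau) :
  straight lam -> straight (domf U) -> increasing U ->
  hecke_word id (row_word (doubling U)) =
    hecke_word id (row_word (doubling (minimal_tableau lam))) ->
  U = minimal_tableau lam.
Proof.
move=> sl sU iU e; set M := minimal_tableau lam in e *.
pose N := \max_(x <- domf U `|` lam) maxn x.1 x.2.
have bound x : x \in domf U `|` lam -> x.1 <= N /\ x.2 <= N.
  move=> h.
  have := leq_bigmax_seq (F := fun x : box => maxn x.1 x.2) (P := xpredT) _ h isT.
  by rewrite -/N geq_max => /andP.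
have bU x : x \in domf U -> x.1 <= N /\ x.2 <= N.
  by move=> h; apply: bound; rewrite in_fsetU h.
have bM x : x \in domf M -> x.1 <= N /\ x.2 <= N.
  by move=> h; apply: bound; rewrite in_fsetU [x \in lam]h orbT.
have iM : increasing M by apply: minimal_increasing.
have sM : straight (domf M) by exact: sl.
move: e; rewrite (straight_row_word sU bU) (straight_row_word sM bM).
set lU := straight_row U N.
pose lM r := run r%:Z (row_length lam N r).
have rowM r : 0 < r -> straight_row M N r = lM r by exact: minimal_row.
rewrite (@eq_rows_from _ (straight_row M N) lM) // => [e|r /andP[r0 _]]; last exact: rowM.
have lM_ge r : 0 < r <= N -> {in lM r, forall y, r%:Z <= y}%R.
  by move=> _; apply: run_ge.
(* Entries of [U] are arbitrary integers, while [minimal_rows_unique] needs those of row [r] to be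
   at least [r]. If the corner [u0] were at most [0], the first row would carry the value [u0] to
   position [u0 + k] with [k > 0]; for [lM], positions below [1] are fixed and all others have
   values at least [1]. *)
have corner u0 : U.[? sort_box 1 1] = Some u0 -> (1 <= u0)%R.
  move=> U0; rewrite leNgt; apply/negP => u0_lt.
  have N1 : 0 < N.
    by have : sort_box 1 1 \in domf U; [move: U0; case: fndP | case/bU].
  have N1E : N - N.-1 = 1 by lia.
  have high y : y \in rows_from N lU N.-1 -> (u0 + 1 <= y)%R.
    apply: (@rows_from_all N lU N.-1 (fun y => u0 + 1 <= y)%R (leq_pred N)).
    move=> r {}y rN rN' /straight_row_mem[c c0 Uy]; have r2 : 1 < r by lia.
    have := straight_entry_ge sU iU U0 (ltnW r2) c0 Uy; lia.
  have top y : y \in lU 1 -> (u0 <= y)%R.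
    move=> /straight_row_mem[c c0 Uy].
    have := straight_entry_ge sU iU U0 (ltn0Sn 0) c0 Uy; lia.
  have u0_mem : u0 \in lU 1.
    rewrite mem_pmap; apply/mapP; exists 1 => //.
    by rewrite mem_iota; lia.
  have [k [tl [lE tl_ge]]] := run_prefix (straight_row_sorted N iU 1) top.
  have k0 : 0 < k.
    rewrite lt0n; apply/negP => /eqP k0; move: u0_mem; rewrite /lU lE k0 /=.
    by move=> /tl_ge; lia.
  have eq_top : hecke_word id (rows_from N lU N) (u0 + k%:Z)%R = u0.
    rewrite -(prednK N1) rows_fromS ?prednK // N1E hecke_word_cat /lU lE.
    rewrite hecke_word_cat (hecke_word_low _ tl_ge); last by lia.
    rewrite run_action.
    - by int_cases.
    - by rewrite (hecke_word_low _ high) //; lia.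
    - move=> y uy; have := @hecke_word_high id _ _ high (fun x h => h) y (ltac:(lia)).
      by rewrite /lU; lia.
  rewrite e in eq_top.
  have [lt|ge] := ltP (u0 + k%:Z)%R 1%R.
    by move: eq_top; rewrite (rows_from_fix lM_ge (leqnn N)) ?subSnn; lia.
  have := rows_from_high lM_ge (leqnn N) (x := (u0 + k%:Z)%R).
  by rewrite subSnn eq_top => /(_ ge); lia.
have lU_ge r : 0 < r <= N -> {in lU r, forall y, r%:Z <= y}%R.
  move=> /andP[r0 _] y /straight_row_mem[c c0 Uy].
  have : U.[? sort_box 1 1].
    by apply: (straight_fnd_le sU (i' := r) (j' := c)) => //; rewrite Uy.
  case U0: (U.[? sort_box 1 1]) => [u0|//] _.
  have := straight_entry_ge sU iU U0 r0 c0 Uy; have := corner _ U0; lia.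
have rowE := minimal_rows_unique (row_length_decr N sl) lU_ge
  (straight_row_sorted N iU) e.
have gridE r c : 0 < r <= N -> 0 < c <= N -> U.[? sort_box r c] = M.[? sort_box r c].
  move=> rN cN; have r0 : 0 < r by case/andP: rN.
  apply: (@pmap_iota_inj (fun c => U.[? sort_box r c]) (fun c => M.[? sort_box r c]) 1 N).
  - by move=> d d1; apply: straight_fnd_le.
  - by move=> d d1; apply: straight_fnd_le.
  - by rewrite -/(straight_row U N r) -/(straight_row M N r) rowM //; apply: rowE.
  - by lia.
apply/fmapP => x; have [xUM|] := boolP (x \in domf U `|` lam); last first.
  rewrite in_fsetU negb_or => /andP[xU xl]; rewrite (not_fnd xU).
  by rewrite not_fnd.
have dx : inDelta x.
  by move: xUM; rewrite in_fsetU => /orP[/(proj1 sU)|/(proj1 sl)].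
have xE : sort_box x.1 x.2 = x by apply: sort_box_id; case/andP: dx.
have [x1 x2] := bound _ xUM; move: dx; rewrite /inDelta => /andP[x0 x12].
rewrite -xE.
by apply: gridE; rewrite ?x1 ?x2 andbT // (leq_trans x0 x12).
Qed.

(** * Invariance under slides and existence of rectifications *)

Lemma forward_slide_invariant (T T' : tableau) : forward_slide T T' ->
  increasing_tableau T' /\
  hecke_word id (row_word (doubling T)) = hecke_word id (row_word (doubling T')).
Proof.
case=> nu [lam [C [a [b [[sk inc] Cmax ab Tab ->]]]]].
split; last exact: (jdt_hecke_word sk inc Cmax ab Tab).
split; last exact: (jdt_increasing sk inc Cmax ab Tab).
by have [nu' sk'] := jdt_skew_shape sk inc Cmax ab Tab; exists nu', (lam `\` C).
Qed.

Lemma slides_invariant (T U : tableau) :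
  clos_refl_trans tableau forward_slide T U -> increasing_tableau T ->
  increasing_tableau U /\
  hecke_word id (row_word (doubling T)) = hecke_word id (row_word (doubling U)).
Proof.
elim=> {T U} [T U|T|T U V _ IH1 _ IH2] /=; first by case/forward_slide_invariant.
  by [].
by case/IH1 => /IH2[iV ->] ->.
Qed.

(** A box with the largest coordinate sum is maximal. *)
Lemma maximal_box_exists (lam : {fset box}) : lam != fset0 ->
  exists x, x \in lam /\ maximal_boxes lam [fset x].
Proof.
case/fset0Pn => x0 x0l.
case: (@arg_maxnP lam [` x0l] xpredT (fun x => (val x).1 + (val x).2)%N isT) => x _ xmax.
exists (val x); split; first exact: valP.
split; first by rewrite fsub1set; apply: valP.
move=> y z; rewrite inE => /eqP-> zl; rewrite box_ltE; apply/negP => /and3P[_ _].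
by have := xmax [` zl] isT; rewrite /= ltnNge => ->.
Qed.

(** Slides into one maximal box of the inner shape at a time; by [jdt_skew_shape] this box then
    leaves the inner shape. *)
Lemma rectification_exists (T : tableau) :
  increasing_tableau T -> exists U, rectifies_to T U.
Proof.
case=> -[nu [lam sk]]; move: {2}#|` lam| (leqnn #|` lam|) => n.
elim: n T nu lam sk => [|n IH] T nu lam sk card inc.
  have lam0 : lam = fset0 by apply/eqP; rewrite -cardfs_eq0 -leqn0.
  exists T; split; last exact: rt_refl.
  by case: sk => snu _ _ ->; rewrite lam0 fsetD0.
have [lam0|lam_neq0] := eqVneq lam fset0.
  exists T; split; last exact: rt_refl.
  by case: sk => snu _ _ ->; rewrite lam0 fsetD0.
have [x [xl xmax]] := maximal_box_exists lam_neq0.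
(* A symmetric interval is nonempty even if [T] has no entries. *)
pose B := \max_(y : domf T) `|T y|%N; pose b : int := Posz B.
have Tb (y : domf T) : (- b <= T y <= b)%R.
  have : `|T y|%N <= B by apply: (@leq_bigmax _ (fun y : domf T => `|T y|%N)).
  by rewrite /b; move: (T y) => v; lia.
have bb : (- b <= b)%R by rewrite /b; lia.
have [nu' sk'] := jdt_skew_shape sk inc xmax bb Tb.
have inc' := jdt_increasing sk inc xmax bb Tb.
have card' : #|` lam `\` [fset x]| <= n.
  by have := cardfsD1 x lam; rewrite xl; lia.
have [U [sU TU]] := IH _ _ _ sk' card' inc'.
exists U; split=> //; apply: rt_trans TU; apply: rt_step.
by exists nu, lam, [fset x], (- b)%R, b.
Qed.

Theorem corollary7p2 (lam : {fset box}) (hlam : straight lam) :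
  unique_rectification_target (minimal_tableau lam) /\
  forall T : tableau, increasing_tableau T ->
    (rectifies_to T (minimal_tableau lam) <->
     hecke_perm (doubling T) = hecke_perm (doubling (minimal_tableau lam))).
Proof.
have permE (S S' : tableau) : hecke_perm S = hecke_perm S' <->
    hecke_word id (row_word S) = hecke_word id (row_word S').
  split=> [e|e]; first by apply: funext => x; rewrite -!hecke_permE e.
  by apply: Sigma_ext => x; rewrite !hecke_permE e.
(* [U] inherits the sorted function of [T] through the slides, and [straight_hecke_unique] then
   identifies it. *)
have unique T U : increasing_tableau T -> rectifies_to T U ->
    hecke_word id (row_word (doubling T)) =
      hecke_word id (row_word (doubling (minimal_tableau lam))) ->
    U = minimal_tableau lam.
  move=> iT [sU TU] e; have [[_ iU] eU] := slides_invariant TU iT.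
  by apply: straight_hecke_unique => //; rewrite -eU.
split.
  split; [exact: minimal_increasing_tableau | exact: hlam |].
  move=> T iT [_ TM] U' TU'; apply: (unique T) => //.
  by case: (slides_invariant TM iT).
move=> T iT; split=> [[_ TM]|/permE e].
  by apply/permE; case: (slides_invariant TM iT).
(* Some rectification exists, and it has to be the minimal tableau. *)
have [U TU] := rectification_exists iT.
by rewrite -(unique T U).
Qed.
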